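(* Let $M$ be a Riemannian manifold with boundary and of bounded geometry, with bounded geometry constants including $R_1,R_2,R_3$. More precisely, suppose $C>0$ is a bound for the partial derivatives up to order $k+1$ of $g^{ij}$ and $g_{ij}$ in normal coordinates. Then there exists $D>0$, depending only on $C$ (with $k$, the dimension $m$ and the bounds $R_1,R_2,R_3$ on the size of the charts fixed), such that if $\kappa_1:U_1\subset\mathbb{R}^m\to M$ and $\kappa_2:U_2\subset\mathbb{R}^m\to M$ are normal charts (normal collar charts of width $(r_1,r_2)$ with $r_1\le R_1$, $r_2\le R_2$, or Gaussian charts of radius $r_3\le R_3$), then for $f:=\kappa_1^{-1}\circ\kappa_2:U_0\subset\mathbb{R}^m\to\mathbb{R}^m$ ($U_0$ being the domain of definition of the composition) $$|D^\alpha f|\le D\qquad\text{for all } |\alpha|\le k .$$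
   Context: Notation. $(M^m,g)$ is a Riemannian manifold of dimension $m$ with (possibly empty) boundary $\partial M$; $\nu$ is the unit inward normal field along $\partial M$. $N(s)=\{\exp^M_{x'}(t\nu_{x'}):x'\in\partial M,\ 0\le t\le s\}$. In coordinates, $g_{ij}=g(\partial_i,\partial_j)$, $(g^{ij})$ is the inverse matrix, $D^\alpha$ is the partial derivative for the multi-index $\alpha$, $|\alpha|=\sum\alpha_i$. $B(0,r)$ denotes an open ball in Euclidean space (or in a tangent space). Charts. For $x\in M-\partial M$ and $r_3>0$ sufficiently small, identifying $T_xM$ with $\mathbb{R}^m$ via an orthonormal basis, the chart $\kappa_x:B(0,r_3)\to M$, $v\mapsto\exp^M_x(v)$, is a Gaussian chart of radius $r_3$. For $x'\in\partial M$, identifying $T_{x'}\partial M$ with $\mathbb{R}^{m-1}$ via an orthonormal basis, and $r_1,r_2>0$ small enough for injectivity, the chart $\kappa_{x'}:B(0,r_1)\times[0,r_2)\to M$, $(v,t)\mapsto\exp^M_y(t\nu_y)$ with $y=\exp^{\partial M}_{x'}(v)$, is a normal collar chart of width $(r_1,r_2)$. Normal charts / normal coordinates are either of these. Bounded geometry. $M$ has bounded geometry if: (N) there is $r_C>0$ such that $\partial M\times[0,r_C)\to M$, $(x,t)\mapsto\exp_x(t\nu_x)$, is a diffeomorphism onto its image; (IC) the injectivity radius $r_{inj}(\partial M)$ is positive; (I) there is $r_i>0$ such that if $r\le r_i$ then for $x\in M-N(r)$ the exponential map is a diffeomorphism on $B(0,r)\subset T_xM$ onto its image; (B1) there exist $0<R_1\le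 r_{inj}(\partial M)$, $0<R_2\le r_C$, $0<R_3\le r_i$ and constants $C_K>0$ (one for each $K$) such that in all normal collar coordinates of width $(r_1,r_2)$ with $r_1\le R_1$, $r_2\le R_2$ and all Gaussian coordinates of radius $r_3\le R_3$ one has $|D^\alpha g_{ij}|\le C_K$ and $|D^\alpha g^{ij}|\le C_K$ for all $|\alpha|\le K$. The numbers $R_1,R_2,R_3,C_K$ are the bounded geometry constants of $M$. The hypothesis on $C$ refers to all normal charts of width at most $(R_1,R_2)$, respectively radius at most $R_3$. *)

(* Defs.v *)
From HB Require Import structures.
From mathcomp Require Import all_boot all_order all_algebra.
From mathcomp Require Import all_classical all_reals all_analysis.
Import Order.TTheory GRing.Theory Num.Theory.
Import numFieldNormedType.Exports.

Set Implicit Arguments.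
Unset Strict Implicit.
Unset Printing Implicit Defensive.

Local Open Scope classical_set_scope.
Local Open Scope ring_scope.

(* The norm that MathComp-Analysis puts on 'rV[R]_m is the sup norm, hence: *)
Definition enorm (R : realType) (m : nat) (v : 'rV[R]_m) : R :=
  Num.sqrt (\sum_i v 0 i ^+ 2).

Definition eball (R : realType) (m : nat) (r : R) : set 'rV[R]_m :=
  [set v | enorm v < r].

Definition evec (R : realType) (m : nat) (i : 'I_m) : 'rV[R]_m := delta_mx 0 i.

(* (v, t) in R^n x R, seen as a point of R^(n+1). *)
Definition snoc (R : realType) (n : nat) (v : 'rV[R]_n) (t : R) : 'rV[R]_n.+1 :=
  \row_i (if unlift ord_max i is Some j then v 0 j else t).

(* R^(m-1) x [0, +oo); this is everything for m = 0. *)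
Definition half_space (R : realType) (m : nat) : set 'rV[R]_m :=
  [set u | forall i : 'I_m, i.+1 = m -> 0 <= u 0 i].
Arguments half_space : clear implicits.

Definition rel_open (T : topologicalType) (S U : set T) : Prop :=
  exists2 V : set T, open V & U = S `&` V.

Definition smooth_open (R : realType) (m : nat) (W : normedModType R)
    (V : set 'rV[R]_m) (F : 'rV[R]_m -> W) : Prop :=
  forall (s : seq 'I_m) (u : 'rV[R]_m), V u ->
    differentiable
      (foldr (fun i (G : 'rV[R]_m -> W) => fun w => 'D_(evec R i) G w) F s) u.

Definition smooth_on (R : realType) (m : nat) (W : normedModType R)
    (S : set 'rV[R]_m) (f : 'rV[R]_m -> W) : Prop :=
  forall p, S p -> exists (V : set 'rV[R]_m) (F : 'rV[R]_m -> W),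
    [/\ open V, V p, smooth_open V F & forall u, S u -> V u -> f u = F u].

(* Partial derivative of a function on S: the increment h ranges over the h <> 0
   with u + h e_i in S, so the derivative is one-sided at the boundary points of
   a subset of the half-space and the usual one at interior points. *)
Definition pderiv (R : realType) (m : nat) (W : normedModType R)
    (S : set 'rV[R]_m) (i : 'I_m) (f : 'rV[R]_m -> W) (u : 'rV[R]_m) : W :=
  lim ((fun h : R => h^-1 *: (f (u + h *: evec R i) - f u))
       @ within [set h : R | S (u + h *: evec R i)] 0^').

Definition mindex_order (m : nat) (alpha : {ffun 'I_m -> nat}) : nat :=
  (\sum_i alpha i)%N.

Definition mderiv (R : realType) (m : nat) (W : normedModType R)
    (S : set 'rV[R]_m) (alpha : {ffun 'I_m -> nat}) (f : 'rV[R]_m -> W) :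
    'rV[R]_m -> W :=
  foldr (fun i G => iter (alpha i) (pderiv S i) G) f (enum 'I_m).

Definition has_deriv_in (R : realType) (m : nat) (I : set R)
    (x : R -> 'rV[R]_m) (s : R) (l : 'rV[R]_m) : Prop :=
  (fun h : R => h^-1 *: (x (s + h) - x s)) @ within [set h : R | I (s + h)] 0^'
    --> l.

(* A local parametrization cmap of M by cdom, together with the matrix
   gram u = (g_ij(u)) of the metric in these coordinates.  Only the values on
   cdom are meaningful. *)
Record rchart (R : realType) (M : Type) (m : nat) := RChart {
  cdom : set 'rV[R]_m ;
  cmap : 'rV[R]_m -> M ;
  gram : 'rV[R]_m -> 'M[R]_m
}.

Definition cim (R : realType) (M : Type) (m : nat) (phi : rchart R M m) : set M :=
  cmap phi @` cdom phi.

Definition pos_def (R : realType) (m : nat) (G : 'M[R]_m) : Prop :=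
  G^T = G /\ forall v : 'rV[R]_m, v != 0 -> 0 < (v *m G *m v^T) 0 0.

(* Domains of charts are open in R^m or open in the half-space. *)
Definition wf_chart (R : realType) (M : Type) (m : nat) (phi : rchart R M m) :
    Prop :=
  [/\ open (cdom phi) \/ rel_open (half_space R m) (cdom phi),
      set_inj (cdom phi) (cmap phi),
      smooth_on (cdom phi) (gram phi) &
      forall u, cdom phi u -> pos_def (gram phi u)].

(* Domain of definition of (cmap psi)^-1 o cmap phi. *)
Definition overlap (R : realType) (M : Type) (m : nat) (phi psi : rchart R M m) :
    set 'rV[R]_m :=
  cdom phi `&` [set u | cim psi (cmap phi u)].

(* (cmap psi)^-1 o cmap phi, with the value 0 outside overlap phi psi. *)
Definition transition (R : realType) (M : Type) (m : nat)
    (phi psi : rchart R M m) (u : 'rV[R]_m) : 'rV[R]_m :=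
  xget 0 [set v | cdom psi v /\ cmap psi v = cmap phi u].

(* J i a = d_i tau^a, for the change of coordinates tau. *)
Definition transition_jacobian (R : realType) (M : Type) (m : nat)
    (phi psi : rchart R M m) (u : 'rV[R]_m) : 'M[R]_m :=
  \matrix_(i, a) pderiv (overlap phi psi) i (transition phi psi) u 0 a.

Definition compatible (R : realType) (M : Type) (m : nat)
    (phi psi : rchart R M m) : Prop :=
  [/\ rel_open (cdom phi) (overlap phi psi) /\
        rel_open (cdom psi) (overlap psi phi),
      smooth_on (overlap phi psi) (transition phi psi),
      smooth_on (overlap psi phi) (transition psi phi) &
      forall u, overlap phi psi u ->
        gram phi u = transition_jacobian phi psi u
          *m gram psi (transition phi psi u) *m (transition_jacobian phi psi u)^T].

(* For an atlas A, this says that cmap phi is a diffeomorphism from cdom phi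
   onto an open subset and that gram phi is the matrix of the metric. *)
Definition chart_for (R : realType) (M : Type) (m : nat)
    (A : set (rchart R M m)) (phi : rchart R M m) : Prop :=
  wf_chart phi /\ forall psi, A psi -> compatible phi psi /\ compatible psi phi.

(* A is the maximal smooth atlas, each chart carrying its metric coefficients. *)
Definition riemannian_manifold (R : realType) (M : topologicalType) (m : nat)
    (A : set (rchart R M m)) : Prop :=
  [/\ hausdorff_space M /\ @second_countable M,
      forall p : M, exists2 phi, A phi & cim phi p,
      forall phi, A phi ->
        {within cdom phi, continuous (cmap phi)} /\
        forall V : set 'rV[R]_m, open V -> open (cmap phi @` (cdom phi `&` V)) &
      forall phi, A phi <-> chart_for A phi].

(* A chart of M whose domain lies in the half-space induces a chart of the
   boundary, with the induced metric. *)
Definition bchart (R : realType) (M : Type) (n : nat) (phi : rchart R M n.+1) :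
    rchart R M n :=
  {| cdom := [set v | cdom phi (snoc v 0)] ;
     cmap := fun v => cmap phi (snoc v 0) ;
     gram := fun v => \matrix_(i, j)
       gram phi (snoc v 0) (lift ord_max i) (lift ord_max j) |}.

Definition batlas (R : realType) (M : Type) (n : nat)
    (A : set (rchart R M n.+1)) : set (rchart R M n) :=
  [set psi | exists phi,
     [/\ A phi, cdom phi `<=` half_space R n.+1 & psi = bchart phi]].

Definition bdry (R : realType) (M : Type) (n : nat) (A : set (rchart R M n.+1)) :
    set M :=
  [set p | exists2 psi, batlas A psi & cim psi p].

Definition christoffel (R : realType) (M : Type) (m : nat) (phi : rchart R M m)
    (k i j : 'I_m) (u : 'rV[R]_m) : R :=
  let dg (a b c : 'I_m) : R :=
    pderiv (cdom phi) a (fun w => gram phi w b c) u in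
  2^-1 * \sum_l invmx (gram phi u) k l * (dg i j l + dg j i l - dg l i j).

Definition geodesic_acc (R : realType) (M : Type) (m : nat) (phi : rchart R M m)
    (u v : 'rV[R]_m) : 'rV[R]_m :=
  \row_k - (\sum_i \sum_j christoffel phi k i j u * v 0 i * v 0 j).

(* The geodesic equation x'' = - Gamma(x)(x', x'), as the first order system
   x' = v, v' = - Gamma(x)(v, v), in some chart around each time. *)
Definition geodesic_on (R : realType) (M : Type) (m : nat)
    (A : set (rchart R M m)) (I : set R) (c : R -> M) : Prop :=
  forall t, I t -> exists (phi : rchart R M m) (x v : R -> 'rV[R]_m),
    A phi /\ \forall s \near t, I s ->
      [/\ cdom phi (x s), c s = cmap phi (x s), has_deriv_in I x s (v s) &
          has_deriv_in I v s (geodesic_acc phi (x s) (v s))].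

(* exp_x(w) = y, for x = cmap phi u and the tangent vector \sum_i w_i d_i at x. *)
Definition is_exp (R : realType) (M : Type) (m : nat) (A : set (rchart R M m))
    (phi : rchart R M m) (u w : 'rV[R]_m) (y : M) : Prop :=
  exists c : R -> M,
    [/\ geodesic_on A `[0, 1] c, c 0 = cmap phi u, c 1 = y &
        exists x : R -> 'rV[R]_m,
          [/\ x 0 = u,
              \forall s \near (0 : R), `[0, 1]%classic s ->
                cdom phi (x s) /\ c s = cmap phi (x s) &
              has_deriv_in `[0, 1] x 0 w]].

(* The rows of E are an orthonormal basis of the tangent space at cmap phi u. *)
Definition orthonormal_frame (R : realType) (M : Type) (m : nat)
    (phi : rchart R M m) (u : 'rV[R]_m) (E : 'M[R]_m) : Prop :=
  E *m gram phi u *m E^T = 1%:M.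

(* kappa is v |-> exp_x(v) on B(0, r), with T_x M identified with R^m by means of
   the frame E, and is a diffeomorphism onto its image. *)
Definition exp_chart (R : realType) (M : Type) (m : nat) (A : set (rchart R M m))
    (phi : rchart R M m) (u : 'rV[R]_m) (E : 'M[R]_m) (r : R)
    (kappa : rchart R M m) : Prop :=
  [/\ chart_for A kappa, cdom kappa = eball r &
      forall v, eball r v -> is_exp A phi u (v *m E) (cmap kappa v)].

Definition injectivity_radius_at (R : realType) (M : Type) (m : nat)
    (A : set (rchart R M m)) (phi : rchart R M m) (u : 'rV[R]_m) (E : 'M[R]_m) :
    \bar R :=
  ereal_sup [set r%:E | r in
    [set r : R | 0 < r /\ exists kappa, exp_chart A phi u E r kappa]].

(* Value +oo for the empty manifold. *)
Definition injectivity_radius (R : realType) (M : Type) (m : nat)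
    (A : set (rchart R M m)) : \bar R :=
  ereal_inf [set rho | exists phi u E,
    [/\ A phi, cdom phi u, orthonormal_frame phi u E &
        rho = injectivity_radius_at A phi u E]].

(* w is the inward unit normal at the boundary point cmap phi u. *)
Definition inward_normal (R : realType) (M : Type) (n : nat)
    (phi : rchart R M n.+1) (u w : 'rV[R]_n.+1) : Prop :=
  [/\ forall j : 'I_n, (w *m gram phi u *m (evec R (lift ord_max j))^T) 0 0 = 0,
      (w *m gram phi u *m w^T) 0 0 = 1 &
      0 < w 0 ord_max].

(* y = exp_p(t nu_p), for p in the boundary. *)
Definition normal_exp (R : realType) (M : Type) (n : nat)
    (A : set (rchart R M n.+1)) (p : M) (t : R) (y : M) : Prop :=
  exists phi (v : 'rV[R]_n) (w : 'rV[R]_n.+1),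
    [/\ A phi /\ cdom phi `<=` half_space R n.+1,
        cdom phi (snoc v 0), p = cmap phi (snoc v 0),
        inward_normal phi (snoc v 0) w &
        is_exp A phi (snoc v 0) (t *: w) y].

(* The set N(s) of the points exp_p(t nu_p), p in the boundary, 0 <= t <= s. *)
Definition collar_nbhd (R : realType) (M : Type) (n : nat)
    (A : set (rchart R M n.+1)) (s : R) : set M :=
  [set y | exists p t, [/\ bdry A p, 0 <= t <= s & normal_exp A p t y]].

Definition gaussian_chart (R : realType) (M : Type) (n : nat)
    (A : set (rchart R M n.+1)) (r : R) (kappa : rchart R M n.+1) : Prop :=
  exists phi u E,
    [/\ A phi, cdom phi u, ~ bdry A (cmap phi u), orthonormal_frame phi u E &
        exp_chart A phi u E r kappa].

Definition collar_chart (R : realType) (M : Type) (n : nat)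
    (A : set (rchart R M n.+1)) (r1 r2 : R) (kappa : rchart R M n.+1) : Prop :=
  [/\ chart_for A kappa,
      cdom kappa = [set z | exists v t,
        [/\ z = snoc v t, eball r1 v & 0 <= t < r2]] &
      exists psi u E,
        [/\ batlas A psi, cdom psi u, orthonormal_frame psi u E &
            forall v t, eball r1 v -> 0 <= t < r2 ->
              exists2 y, is_exp (batlas A) psi u (v *m E) y &
                         normal_exp A y t (cmap kappa (snoc v t))]].

Definition normal_chart (R : realType) (M : Type) (n : nat)
    (A : set (rchart R M n.+1)) (R1 R2 R3 : R) (kappa : rchart R M n.+1) : Prop :=
  (exists r1 r2, [/\ 0 < r1 <= R1, 0 < r2 <= R2 & collar_chart A r1 r2 kappa]) \/
  (exists2 r3, 0 < r3 <= R3 & gaussian_chart A r3 kappa).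

Definition metric_bound (R : realType) (M : Type) (n : nat)
    (A : set (rchart R M n.+1)) (R1 R2 R3 : R) (K : nat) (C : R) : Prop :=
  forall kappa, normal_chart A R1 R2 R3 kappa ->
  forall alpha : {ffun 'I_n.+1 -> nat}, (mindex_order alpha <= K)%N ->
  forall i j u, cdom kappa u ->
    `|mderiv (cdom kappa) alpha (fun w => gram kappa w i j) u| <= C /\
    `|mderiv (cdom kappa) alpha (fun w => invmx (gram kappa w) i j) u| <= C.

(* (p, t) |-> exp_p(t nu_p) is a diffeomorphism from
   bdry x [0, rC) onto its image. *)
Definition normal_collar (R : realType) (M : Type) (n : nat)
    (A : set (rchart R M n.+1)) (rC : R) : Prop :=
  (forall psi, batlas A psi -> exists kappa,
     [/\ chart_for A kappa,
         cdom kappa = [set z | exists v t,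
           [/\ z = snoc v t, cdom psi v & 0 <= t < rC]] &
         forall v t, cdom psi v -> 0 <= t < rC ->
           normal_exp A (cmap psi v) t (cmap kappa (snoc v t))]) /\
  (forall p q s t y, 0 <= s < rC -> 0 <= t < rC ->
     normal_exp A p s y -> normal_exp A q t y -> p = q /\ s = t).

(* For 0 < r <= ri and x outside N(r), exp_x is a diffeomorphism from the ball
   B(0, r) of T_x M onto its image. *)
Definition interior_exp (R : realType) (M : Type) (n : nat)
    (A : set (rchart R M n.+1)) (ri : R) : Prop :=
  forall r, 0 < r <= ri ->
  forall phi u E, A phi -> cdom phi u -> ~ collar_nbhd A r (cmap phi u) ->
    orthonormal_frame phi u E -> exists kappa, exp_chart A phi u E r kappa.

(* Bounded geometry, with R1, R2, R3 among the bounded geometry constants. *)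
Definition bounded_geometry (R : realType) (M : Type) (n : nat)
    (A : set (rchart R M n.+1)) (R1 R2 R3 : R) : Prop :=
  exists rC ri : R,
    [/\ 0 < rC /\ normal_collar A rC,
        (0 < injectivity_radius (batlas A))%E,
        0 < ri /\ interior_exp A ri,
        [/\ 0 < R1 /\ (R1%:E <= injectivity_radius (batlas A))%E,
            0 < R2 <= rC & 0 < R3 <= ri] &
        exists CK : nat -> R, forall K,
          0 < CK K /\ metric_bound A R1 R2 R3 K (CK K)].

(* Main.v *)
Require Import Defs.
From HB Require Import structures.
From mathcomp Require Import all_boot all_order all_algebra.
From mathcomp Require Import all_classical all_reals all_analysis.
From mathcomp Require Import ring lra.
Import Order.TTheory GRing.Theory Num.Theory.
Import numFieldNormedType.Exports.
Local Open Scope classical_set_scope.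
Local Open Scope ring_scope.

(** The transition [f] of two charts is an isometry: [g = J g'(f) J^T] for its
Jacobian [J].  Positivity of [g'] and the bound on its inverse bound [J].
Differentiating the identity and using the symmetry of the second derivatives,
as for the Christoffel symbols, expresses the second derivatives of [f] as
polynomials in [g^-1], the first derivatives of [g], those of [g'] composed with
[f], and [J]; by induction on the order all derivatives of [f] are bounded in
terms of the bounds on the metric.  The bound on [f] itself
is the size of the charts.  Partial derivatives on a subset of the half-space
are handled through local extensions to open sets. *)

Set Implicit Arguments.
Unset Strict Implicit.
Unset Printing Implicit Defensive.

(** The domain of [f] may be disconnected, far from convex and contain boundary points, so no
    estimate compares values at two of its points: every bound is read off from an identity at a
    single point. The induction closes without loss of order because the formula for the second
    derivatives contains [J] only undifferentiated: [r] bounded derivatives of [J] and [r + 1] of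
    the metrics bound [r] derivatives of the Hessian, hence [r + 1] of [J]. The derivatives of [g']
    composed with [f] fit in, since by the chain rule their derivatives up to order [r] involve [J]
    only to orders below [r]. Uniformity is carried by the order of quantifiers: each estimate fixes
    its constant before any set or function is introduced, and the manifold enters only at the
    end. *)

(* Makes the limits defining [pderiv] unique. *)
Definition thick (R : realType) (m : nat) (S : set 'rV[R]_m) : Prop :=
  forall u i, S u ->
    ProperFilter (within [set h : R | S (u + h *: evec R i)] 0^').

(** * Differentiation on a subset through local extensions *)

(** The extension may depend on [p] and is differentiable at [p] alone. This weak form passes
    through sums, products, compositions and matrix inverses, and suffices for the first order
    rules. *)
Definition ext_differentiable (R : realType) (m : nat) (W : normedModType R)
    (S : set 'rV[R]_m) (f : 'rV[R]_m -> W) (p : 'rV[R]_m) : Prop :=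
  exists2 F : 'rV[R]_m -> W, differentiable F p &
    \forall u \near p, S u -> f u = F u.

Lemma near_line {R : realType} {m : nat} {P : set 'rV[R]_m} {u : 'rV[R]_m}
    (e : 'rV[R]_m) :
  (\forall w \near u, P w) -> \forall h \near (0 : R), P (u + h *: e).
Proof.
move=> Pu.
have : (fun h : R => u + h *: e) @ (0 : R) --> u + (0 : R) *: e.
  apply: cvgD; first exact: cvg_cst.
  exact: scalel_continuous.
rewrite scale0r addr0 => cvg0.
exact: cvg0.
Qed.

(** A small positive increment along a coordinate axis lowers no coordinate, so it stays in the
    half-space; positive [h] alone already make the filter proper. *)
Lemma thick_open (R : realType) (m : nat) (S : set 'rV[R]_m) :
  open S \/ rel_open (half_space R m) S -> thick S.
Proof.
move=> oS u i Su; apply: Build_ProperFilter_ex => P.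
rewrite /within /= => nP.
have S0 : \forall h \near (0 : R), 0 < h -> S (u + h *: evec R i).
  case: oS => [oS|[V oV SE]].
    have: \forall h \near (0 : R), S (u + h *: evec R i).
      by apply: near_line; apply: open_nbhs_nbhs.
    by apply: filterS.
  move: (Su); rewrite SE => -[Hu Vu].
  have: \forall h \near (0 : R), V (u + h *: evec R i).
    by apply: near_line; apply: open_nbhs_nbhs.
  apply: filterS => h Vh h0; split=> // j jm.
  rewrite !mxE addr_ge0 ?Hu//; apply: mulr_ge0; [exact: ltW|exact: ler0n].
have S0' : \forall h \near 0^'+, S (u + h *: evec R i) by exact: S0.
have P0 : \forall h \near 0^'+, S (u + h *: evec R i) -> P h.
  have nP' : \forall h \near (0 : R), h != 0 -> S (u + h *: evec R i) -> P h.
    exact: nP.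
  apply: filterS nP' => h hP h0; apply: hP; exact: lt0r_neq0.
have [h [Sh Ph]] := filter_ex (filterI S0' P0); exists h; exact: Ph.
Qed.

(** The quotients of [F] converge along all of [0^'], hence along the admissible increments, where
    they are those of [f]; thickness makes the limit unique. Every rule below is thereby reduced to
    its counterpart on the ambient space. *)
Lemma pderivE (R : realType) (m : nat) (W : normedModType R)
    (S : set 'rV[R]_m) (i : 'I_m) (f F : 'rV[R]_m -> W) (p : 'rV[R]_m) :
  thick S -> S p -> differentiable F p ->
  (\forall u \near p, S u -> f u = F u) ->
  pderiv S i f p = 'D_(evec R i) F p.
Proof.
move=> tS Sp dF fF; have ? := tS p i Sp.
apply: cvg_lim => //.
have /diff_derivable dF' := dF; have {dF'} := derivableP (dF' (evec R i)).
case => /cvg_ex[l cl] _.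
have lE : l = 'D_(evec R i) F p by apply/esym/cvg_lim.
rewrite -lE; apply: cvg_trans; last first.
  exact: (@cvg_within_filter _ _ _ _ _ _ [set h : R | S (p + h *: evec R i)] cl).
apply: near_eq_cvg; rewrite /prop_near1 /within /=.
have fFp : f p = F p by apply: (nbhs_singleton fF).
have := near_line (evec R i) fF => nf.
have : \forall h \near 0^', S (p + h *: evec R i) ->
    f (p + h *: evec R i) = F (p + h *: evec R i).
  by apply: cvg_within.
by apply: filterS => h hh Sh /=; rewrite hh// fFp /= (addrC p).
Qed.

Lemma ext_differentiable_subset (R : realType) (m : nat) (W : normedModType R)
    (S S' : set 'rV[R]_m) (f g : 'rV[R]_m -> W) (p : 'rV[R]_m) :
  S' `<=` S -> (forall u, S' u -> g u = f u) -> ext_differentiable S f p ->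
  ext_differentiable S' g p.
Proof.
move=> sS gf [F dF fF]; exists F => //; apply: filterS fF => u fF S'u.
by rewrite gf// fF//; exact: sS.
Qed.

(** Besides restricting to a smaller set, this serves with [S' = S] as the congruence rule:
    identities that hold only on [S] may be used under [pderiv S]. *)
Lemma pderiv_subset (R : realType) (m : nat) (W : normedModType R)
    (S S' : set 'rV[R]_m) (f g : 'rV[R]_m -> W) (p : 'rV[R]_m) (i : 'I_m) :
  thick S -> thick S' -> S' `<=` S -> (forall u, S' u -> g u = f u) ->
  S' p -> ext_differentiable S f p -> pderiv S' i g p = pderiv S i f p.
Proof.
move=> tS tS' sS gf S'p [F dF fF].
rewrite (pderivE _ tS (sS _ S'p) dF fF); apply: pderivE => //.
by apply: filterS fF => u fF S'u; rewrite gf// fF//; exact: sS.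
Qed.

Lemma ext_differentiable_cst (R : realType) (m : nat) (W : normedModType R)
    (S : set 'rV[R]_m) (c : W) (p : 'rV[R]_m) :
  ext_differentiable S (fun=> c) p.
Proof. by exists (cst c); [exact: differentiable_cst|by apply: filterE]. Qed.

Lemma pderiv_cst (R : realType) (m : nat) (W : normedModType R)
    (S : set 'rV[R]_m) (c : W) (p : 'rV[R]_m) (i : 'I_m) :
  thick S -> S p -> pderiv S i (fun=> c) p = 0.
Proof.
move=> tS Sp; rewrite (@pderivE _ _ _ _ _ _ (cst c))//; last by apply: filterE.
exact: derive_cst.
Qed.

Lemma ext_differentiableD (R : realType) (m : nat) (W : normedModType R)
    (S : set 'rV[R]_m) (f g : 'rV[R]_m -> W) (p : 'rV[R]_m) :
  ext_differentiable S f p -> ext_differentiable S g p ->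
  ext_differentiable S (fun u => f u + g u) p.
Proof.
move=> [F dF fF] [G dG gG]; exists (F + G); first exact: differentiableD.
by apply: filterS2 fF gG => u fF gG Su; rewrite fF// gG.
Qed.

Lemma pderivD (R : realType) (m : nat) (W : normedModType R)
    (S : set 'rV[R]_m) (f g : 'rV[R]_m -> W) (p : 'rV[R]_m) (i : 'I_m) :
  thick S -> S p -> ext_differentiable S f p -> ext_differentiable S g p ->
  pderiv S i (fun u => f u + g u) p = pderiv S i f p + pderiv S i g p.
Proof.
move=> tS Sp [F dF fF] [G dG gG].
rewrite (pderivE _ _ _ dF fF)// (pderivE _ _ _ dG gG)//.
rewrite -deriveD; [|exact: diff_derivable..].
apply: pderivE => //; first exact: differentiableD.
by apply: filterS2 fF gG => u fF gG Su; rewrite fF// gG.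
Qed.

Lemma ext_differentiable_sum (R : realType) (m : nat) (W : normedModType R)
    (S : set 'rV[R]_m) (I : Type) (s : seq I) (f : I -> 'rV[R]_m -> W)
    (p : 'rV[R]_m) :
  (forall j, ext_differentiable S (f j) p) ->
  ext_differentiable S (fun u => \sum_(j <- s) f j u) p.
Proof.
move=> df; elim: s => [|j s IH].
  by under eq_fun do rewrite big_nil; exact: ext_differentiable_cst.
by under eq_fun do rewrite big_cons; exact: ext_differentiableD.
Qed.

Lemma pderiv_sum (R : realType) (m : nat) (W : normedModType R)
    (S : set 'rV[R]_m) (I : Type) (s : seq I) (f : I -> 'rV[R]_m -> W)
    (p : 'rV[R]_m) (i : 'I_m) :
  thick S -> S p -> (forall j, ext_differentiable S (f j) p) ->
  pderiv S i (fun u => \sum_(j <- s) f j u) p =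
  \sum_(j <- s) pderiv S i (f j) p.
Proof.
move=> tS Sp df; elim: s => [|j s IH].
  by rewrite big_nil; under eq_fun do rewrite big_nil; exact: pderiv_cst.
rewrite big_cons -IH; under eq_fun do rewrite big_cons.
by apply: pderivD => //; exact: ext_differentiable_sum.
Qed.

Lemma ext_differentiableM (R : realType) (m : nat)
    (S : set 'rV[R]_m) (f g : 'rV[R]_m -> R) (p : 'rV[R]_m) :
  ext_differentiable S f p -> ext_differentiable S g p ->
  ext_differentiable S (fun u => f u * g u) p.
Proof.
move=> [F dF fF] [G dG gG]; exists (F * G); first exact: differentiableM.
by apply: filterS2 fF gG => u fF gG Su; rewrite fF// gG.
Qed.

Lemma pderivM (R : realType) (m : nat)
    (S : set 'rV[R]_m) (f g : 'rV[R]_m -> R) (p : 'rV[R]_m) (i : 'I_m) :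
  thick S -> S p -> ext_differentiable S f p -> ext_differentiable S g p ->
  pderiv S i (fun u => f u * g u) p =
  f p * pderiv S i g p + g p * pderiv S i f p.
Proof.
move=> tS Sp [F dF fF] [G dG gG].
rewrite (pderivE _ _ _ dF fF)// (pderivE _ _ _ dG gG)//.
rewrite (nbhs_singleton fF)// (nbhs_singleton gG)//.
have := @deriveM _ _ F G p (evec R i) (diff_derivable dF) (diff_derivable dG).
rewrite /GRing.scale /= => <-.
apply: pderivE => //; first exact: differentiableM.
by apply: filterS2 fF gG => u fF gG Su; rewrite fF// gG.
Qed.

Lemma ext_differentiable_comp (R : realType) (m n : nat) (W : normedModType R)
    (S : set 'rV[R]_m) (S' : set 'rV[R]_n) (f : 'rV[R]_m -> 'rV[R]_n)
    (G : 'rV[R]_n -> W) (p : 'rV[R]_m) :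
  (forall u, S u -> S' (f u)) -> S p -> ext_differentiable S f p ->
  ext_differentiable S' G (f p) -> ext_differentiable S (fun u => G (f u)) p.
Proof.
move=> fS Sp [F dF fF] [H dH GH].
have fFp : f p = F p by apply: (nbhs_singleton fF).
rewrite fFp in dH GH.
exists (H \o F); first exact: differentiable_comp.
have := differentiable_continuous dF GH; rewrite nbhs_simpl /= => nG.
apply: filterS2 fF nG => u fF nG Su; rewrite fF// nG// -fF//; exact: fS.
Qed.

Lemma row_sum_evec (R : realType) (m : nat) (v : 'rV[R]_m) :
  v = \sum_a v 0 a *: evec R a.
Proof. exact: row_sum_delta. Qed.

(** The curve traced by [f] need not follow the axes of [S'], so one-sided partial derivatives of
    [G] alone would not control it. The differential of the extension [H] does, and its values on
    the basis are those partial derivatives. *)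
Lemma pderiv_comp (R : realType) (m n : nat) (W : normedModType R)
    (S : set 'rV[R]_m) (S' : set 'rV[R]_n) (f : 'rV[R]_m -> 'rV[R]_n)
    (G : 'rV[R]_n -> W) (p : 'rV[R]_m) (i : 'I_m) :
  thick S -> thick S' -> (forall u, S u -> S' (f u)) -> S p ->
  ext_differentiable S f p -> ext_differentiable S' G (f p) ->
  pderiv S i (fun u => G (f u)) p =
  \sum_a pderiv S i f p 0 a *: pderiv S' a G (f p).
Proof.
move=> tS tS' fS Sp [F dF fF] [H dH GH].
have fFp : f p = F p by apply: (nbhs_singleton fF).
have S'Fp : S' (F p) by rewrite -fFp; exact: fS.
rewrite fFp in dH GH *.
rewrite (pderivE _ tS Sp dF fF).
under eq_bigr do rewrite (pderivE _ tS' S'Fp dH GH) (deriveE _ dH).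
have -> : \sum_a 'D_(evec R i) F p 0 a *: 'd H (F p) (evec R a)
    = 'd H (F p) ('d F p (evec R i)).
  rewrite -(deriveE _ dF) [in RHS](row_sum_evec ('D_(evec R i) F p)) linear_sum.
  by apply: eq_bigr => a _; rewrite linearZ.
have dHF : differentiable (H \o F) p by exact: differentiable_comp.
transitivity ('D_(evec R i) (H \o F) p); last first.
  by rewrite (deriveE _ dHF) diff_comp.
apply: pderivE => //.
have := differentiable_continuous dF GH; rewrite nbhs_simpl /= => nG.
apply: filterS2 fF nG => u fF nG Su; rewrite fF// nG// -fF//; exact: fS.
Qed.

(** * Young's theorem *)

Lemma is_derive_line (R : realType) (V W : normedModType R) (F : V -> W)
    (q e : V) (s : R) :
  derivable F (q + s *: e) e ->
  is_derive s (1 : R) (fun t : R => F (q + t *: e)) ('D_e F (q + s *: e)).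
Proof.
have E : (fun h : R => h^-1 *:
      (((fun t : R => F (q + t *: e)) \o shift s) (h *: (1 : R))
       - F (q + s *: e)))
    = (fun h : R => h^-1 *:
      ((F \o shift (q + s *: e)) (h *: e) - F (q + s *: e))).
  apply/funext => h /=; congr (_ *: (F _ - _)).
  by rewrite [h *: 1]mulr1 scalerDl addrCA.
by move=> dF; split; rewrite /derivable /derive E.
Qed.

Section Young.
Context {R : realType} {V : normedModType R}.
Implicit Types (F G H : V -> R) (p e d : V).

(** The mean value theorem along [e], applied to the difference of [F] on two parallel segments,
    leaves an increment of [G] over [h *: d]. Differentiability of [G] at the single point [p] then
    evaluates it to first order. *)
Lemma second_difference F G p e d (eps : R) :
  (\forall w \near p, differentiable F w /\ 'D_e F w = G w) ->
  differentiable G p -> 0 < eps ->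
  \forall h \near 0^'+,
    `|F (p + h *: e + h *: d) - F (p + h *: e) - F (p + h *: d) + F p
      - h ^+ 2 * 'D_d G p| <= eps * h ^+ 2.
Proof.
move=> dF dG eps0.
pose N := `|e| + `|d| + 1.
have N0 : 0 < N by rewrite ltr_wpDl// addr_ge0.
have /eqaddoP oG := diff_locally dG.
(* Two expansions of [G] will be subtracted, each on a vector of norm at most [h * N]; this
   tolerance makes each error at most [eps / 2 * h]. *)
have eps'0 : 0 < eps / (2 * N) by rewrite divr_gt0// mulr_gt0.
have {oG} := oG _ eps'0.
move: dF => /nbhs_ballP[r /= r0 dF] /nbhs_ballP[r' /= r'0 oG].
near=> h.
have h0 : 0 < h by near: h; exact: nbhs_right_gt.
have hN (x y : R) : 0 <= x <= h -> 0 <= y <= h ->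
    `|x *: e + y *: d| <= h * N.
  move=> /andP[x0 xh] /andP[y0 yh].
  rewrite (le_trans (ler_normD _ _))// !normrZ !ger0_norm// /N.
  rewrite !mulrDr mulr1 -[leLHS]addr0 lerD ?(ltW h0)//.
  by rewrite lerD// ler_wpM2r.
have hr : h * N < r.
  rewrite -ltr_pdivlMr//; near: h; apply: nbhs_right_lt; exact: divr_gt0.
have hr' : h * N < r'.
  rewrite -ltr_pdivlMr//; near: h; apply: nbhs_right_lt; exact: divr_gt0.
have {}dF x y : 0 <= x <= h -> 0 <= y <= h ->
    differentiable F (p + x *: e + y *: d) /\
    'D_e F (p + x *: e + y *: d) = G (p + x *: e + y *: d).
  move=> hx hy; apply: dF; rewrite -ball_normE /ball_ /=.
  by rewrite -addrA opprD addNKr normrN (le_lt_trans (hN _ _ hx hy)).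
have {}oG x y : 0 <= x <= h -> 0 <= y <= h ->
    `|G (p + x *: e + y *: d) - G p - 'd G p (x *: e + y *: d)|
      <= eps / 2 * h.
  move=> hx hy.
  have := oG (x *: e + y *: d); rewrite -ball_normE /ball_ /= sub0r normrN.
  move=> /(_ (le_lt_trans (hN _ _ hx hy) hr')).
  rewrite !fctE /= opprD addrA (addrC _ p) addrA => /le_trans; apply.
  rewrite (le_trans (ler_wpM2l (ltW eps'0) (hN _ _ hx hy)))//.
  rewrite le_eqVlt; apply/orP; left; apply/eqP; field.
  by rewrite gt_eqF.
have h00 : 0 <= (0 : R) <= h by rewrite lexx ltW.
have hh : 0 <= h <= h by rewrite lexx ltW.
pose phi (y t : R) := F (p + y *: d + t *: e).
have dphi y t : 0 <= t <= h -> 0 <= y <= h ->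
    is_derive t (1 : R) (phi y) (G (p + t *: e + y *: d)).
  move=> ht hy; have [dFt <-] := dF t y ht hy.
  rewrite addrAC; apply: is_derive_line; apply: diff_derivable.
  by rewrite addrAC.
pose psi : R -> R := phi h - phi 0.
have dpsi t : 0 <= t <= h ->
    is_derive t (1 : R) psi (G (p + t *: e + h *: d) - G (p + t *: e + 0 *: d)).
  move=> ht; apply: is_deriveB; exact: dphi.
have [] := @MVT _ psi
  (fun t => G (p + t *: e + h *: d) - G (p + t *: e + 0 *: d)) 0 h h0.
- move=> t; rewrite in_itv /= => /andP[t0 th].
  by apply: dpsi; rewrite !ltW.
- apply: derivable_within_continuous => t; rewrite in_itv /= => ht.
  by case: (dpsi t ht).
move=> t; rewrite in_itv /= subr0 => /andP[t0 th].
have ht : 0 <= t <= h by rewrite !ltW.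
rewrite /psi /phi !fctE /= scale0r !addr0 => E.
have -> : F (p + h *: e + h *: d) - F (p + h *: e) - F (p + h *: d) + F p
    = (G (p + t *: e + h *: d) - G (p + t *: e + 0 *: d)) * h.
  rewrite scale0r addr0 -E scale0r !addr0 (addrAC p); ring.
have A1 := oG t h ht hh.
have A2 := oG t 0 ht h00.
rewrite (deriveE _ dG).
(* The unknown intermediate [t] cancels here: both linear parts contain the same [t *: e]. *)
have L : 'd G p (t *: e + h *: d) - 'd G p (t *: e + 0 *: d) = h * 'd G p d.
  by rewrite -linearB /= opprD addrACA subrr add0r scale0r subr0 linearZ.
set g1 := G _ in A1 *; set g2 := G (_ + 0 *: d) in A2 *.
set d1 := 'd G p _ in A1 L; set d2 := 'd G p (_ + 0 *: d) in A2 L.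
set D := 'd G p d in L *; set g0 := G p in A1 A2.
have -> : (g1 - g2) * h - h ^+ 2 * D = h * ((g1 - g0 - d1) - (g2 - g0 - d2)).
  have -> : h ^+ 2 * D = h * (d1 - d2) by rewrite L; ring.
  ring.
rewrite normrM (gtr0_norm h0).
have -> : eps * h ^+ 2 = h * (eps / 2 * h + eps / 2 * h) by field.
rewrite ler_pM2l// (le_trans (ler_normB _ _))// lerD//.
Unshelve. all: by end_near. Qed.

(* Symmetry of second derivatives: both are limits of the same second
   difference quotient. *)
Lemma derive_comm F G H p e d :
  (\forall w \near p,
     [/\ differentiable F w, 'D_e F w = G w & 'D_d F w = H w]) ->
  differentiable G p -> differentiable H p -> 'D_d G p = 'D_e H p.
Proof.
move=> FGH dG dH; apply/eqP; rewrite -subr_eq0 -normr_le0.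
apply/ler_addgt0Pl => eps eps0; rewrite addr0.
have eps2 : 0 < eps / 2 by rewrite divr_gt0.
have FG : \forall w \near p, differentiable F w /\ 'D_e F w = G w.
  by apply: filterS FGH => w [].
have FH : \forall w \near p, differentiable F w /\ 'D_d F w = H w.
  by apply: filterS FGH => w [].
have [h [h0 [/= A B]]] := filter_ex (filterI (nbhs_right_gt (0 : R))
  (filterI (second_difference d FG dG eps2) (second_difference e FH dH eps2))).
have h2 : 0 < h ^+ 2 by rewrite exprn_gt0.
rewrite -(ler_pM2l h2) -[X in X * _](gtr0_norm h2) -normrM.
rewrite (addrAC p) in B.
set a := F (_ + _ + _) in A B; set b := F _ in A.
set c := F (_ + h *: d) in A B.
have -> : h ^+ 2 * ('D_d G p - 'D_e H p)
   = (a - c - b + F p - h ^+ 2 * 'D_e H p)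
     - (a - b - c + F p - h ^+ 2 * 'D_d G p).
  ring.
rewrite (le_trans (ler_normB _ _))// (le_trans (lerD B A))//.
by rewrite le_eqVlt; apply/orP; left; apply/eqP; field.
Qed.

End Young.

(** * Iterated partial derivatives of smooth maps and multi-indices *)

Lemma smooth_on_ext_differentiable (R : realType) (m : nat)
    (W : normedModType R) (S : set 'rV[R]_m) (f : 'rV[R]_m -> W)
    (p : 'rV[R]_m) :
  smooth_on S f -> S p -> ext_differentiable S f p.
Proof.
move=> sf Sp; have [V [F [oV Vp sF fF]]] := sf p Sp.
exists F; first exact: (sF [::]).
have : nbhs p V by exact: open_nbhs_nbhs.
by apply: filterS => u Vu Su; exact: fF.
Qed.

(** A single [F] serves all points of [S] near [p] and all directions, so its derivatives extend
    those of [f], and the argument can be iterated. *)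
Lemma smooth_on_pderivE (R : realType) (m : nat)
    (W : normedModType R) (S : set 'rV[R]_m) (f : 'rV[R]_m -> W)
    (p : 'rV[R]_m) :
  thick S -> smooth_on S f -> S p ->
  exists V (F : 'rV[R]_m -> W), [/\ open V, V p, smooth_open V F,
    forall u, S u -> V u -> f u = F u &
    forall i u, S u -> V u -> pderiv S i f u = 'D_(evec R i) F u].
Proof.
move=> tS sf Sp; have [V [F [oV Vp sF fF]]] := sf p Sp.
exists V, F; split=> // i u Su Vu; apply: pderivE => //; first exact: (sF [::]).
have : nbhs u V by exact: open_nbhs_nbhs.
by apply: filterS => w Vw Sw; exact: fF.
Qed.

Lemma smooth_open_derive (R : realType) (m : nat) (W : normedModType R)
    (V : set 'rV[R]_m) (F : 'rV[R]_m -> W) (i : 'I_m) :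
  smooth_open V F -> smooth_open V ('D_(evec R i) F).
Proof.
by move=> sF s u Vu; have := sF (rcons s i) u Vu; rewrite foldr_rcons.
Qed.

Lemma smooth_on_pderiv (R : realType) (m : nat) (W : normedModType R)
    (S : set 'rV[R]_m) (f : 'rV[R]_m -> W) (i : 'I_m) :
  thick S -> smooth_on S f -> smooth_on S (pderiv S i f).
Proof.
move=> tS sf p Sp; have [V [F [oV Vp sF _ dF]]] := smooth_on_pderivE tS sf Sp.
exists V, ('D_(evec R i) F); split=> //; first exact: smooth_open_derive.
exact: dF.
Qed.

Lemma smooth_on_iter_pderiv (R : realType) (m : nat) (W : normedModType R)
    (S : set 'rV[R]_m) (f : 'rV[R]_m -> W) (s : seq 'I_m) :
  thick S -> smooth_on S f -> smooth_on S (foldr (pderiv S) f s).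
Proof. by move=> tS sf; elim: s => //= i s; exact: smooth_on_pderiv. Qed.

Lemma differentiable_comp_coord (R : realType) (V : normedModType R) (a b : nat)
    (F : V -> 'M[R]_(a, b)) (p : V) i j :
  differentiable F p -> differentiable (fun w => F w i j) p.
Proof.
move=> dF.
apply: (differentiable_comp (g := fun N : 'M[R]_(a, b) => N i j)) => //.
exact: differentiable_coord.
Qed.

Lemma derive_coord (R : realType) (V : normedModType R) (a b : nat)
    (F : V -> 'M[R]_(a, b)) (p v : V) i j :
  differentiable F p -> 'D_v (fun w => F w i j) p = 'D_v F p i j.
Proof. by move=> dF; rewrite derive_mx ?mxE//; exact: diff_derivable. Qed.

Lemma smooth_open_comm (R : realType) (m a b : nat) (V : set 'rV[R]_m)
    (F : 'rV[R]_m -> 'M[R]_(a, b)) (i j : 'I_m) (p : 'rV[R]_m) :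
  open V -> smooth_open V F -> V p ->
  'D_(evec R i) ('D_(evec R j) F) p = 'D_(evec R j) ('D_(evec R i) F) p.
Proof.
move=> oV sF Vp; apply/matrixP => x y.
have dD k : differentiable ('D_(evec R k) F) p by exact: (sF [:: k]).
have E k l : 'D_(evec R k) ('D_(evec R l) F) p x y
    = 'D_(evec R k) (fun w => 'D_(evec R l) F w x y) p.
  by apply/esym; exact: derive_coord.
apply: etrans (E i j) _; apply: etrans _ (esym (E j i)).
apply: (@derive_comm _ _ (fun w => F w x y));
  try exact: differentiable_comp_coord.
have : nbhs p V by exact: open_nbhs_nbhs.
apply: filterS => w Vw; have dF : differentiable F w by exact: (sF [::]).
by split; [exact: differentiable_comp_coord|rewrite derive_coord..].
Qed.

Lemma pderiv_comm (R : realType) (m a b : nat) (S : set 'rV[R]_m)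
    (f : 'rV[R]_m -> 'M[R]_(a, b)) (i j : 'I_m) (p : 'rV[R]_m) :
  thick S -> smooth_on S f -> S p ->
  pderiv S i (pderiv S j f) p = pderiv S j (pderiv S i f) p.
Proof.
move=> tS sf Sp; have [V [F [oV Vp sF _ dF]]] := smooth_on_pderivE tS sf Sp.
have E k l : pderiv S k (pderiv S l f) p = 'D_(evec R k) ('D_(evec R l) F) p.
  apply: pderivE => //; first exact: (sF [:: l]).
  have : nbhs p V by exact: open_nbhs_nbhs.
  by apply: filterS => u Vu Su; exact: dF.
by rewrite !E; exact: smooth_open_comm sF Vp.
Qed.

Lemma iter_pderiv_move (R : realType) (m a b : nat) (S : set 'rV[R]_m)
    (f : 'rV[R]_m -> 'M[R]_(a, b)) (i : 'I_m) (s t : seq 'I_m) (p : 'rV[R]_m) :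
  thick S -> smooth_on S f -> S p ->
  foldr (pderiv S) f (s ++ i :: t) p = foldr (pderiv S) f (i :: s ++ t) p.
Proof.
move=> tS sf; elim: s p => [//|j s IH] p Sp.
have sm u := smooth_on_iter_pderiv u tS sf.
apply: etrans (pderiv_comm j i tS (sm (s ++ t)) Sp).
apply: pderiv_subset => //.
by apply: smooth_on_ext_differentiable => //; exact/smooth_on_pderiv/sm.
Qed.

(** [mderiv] differentiates in one fixed order of the indices, whereas inductions on the order of
    differentiation produce every order. *)
Lemma iter_pderiv_perm (R : realType) (m a b : nat) (S : set 'rV[R]_m)
    (f : 'rV[R]_m -> 'M[R]_(a, b)) (s t : seq 'I_m) (p : 'rV[R]_m) :
  thick S -> smooth_on S f -> S p -> perm_eq s t ->
  foldr (pderiv S) f s p = foldr (pderiv S) f t p.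
Proof.
move=> tS sf; elim: s t p => [|i s IH] t p Sp st.
  by move: st; rewrite perm_sym => /perm_nilP ->.
have /splitPr E : i \in t by rewrite -(perm_mem st) mem_head.
case: E st => t1 t2 st; rewrite iter_pderiv_move//=.
apply: pderiv_subset => // [u Su|].
  apply: IH => //; rewrite -(perm_cons i) (perm_trans st)//.
  by rewrite perm_catC /= perm_cons perm_catC.
apply: smooth_on_ext_differentiable => //; exact: smooth_on_iter_pderiv.
Qed.

(** Links the bounds, which concern scalar entries, with [gram] and [transition], which are smooth
    as matrix-valued maps. *)
Lemma iter_pderiv_coord (R : realType) (m a b : nat) (S : set 'rV[R]_m)
    (f : 'rV[R]_m -> 'M[R]_(a, b)) (x : 'I_a) (y : 'I_b) (s : seq 'I_m)
    (p : 'rV[R]_m) :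
  thick S -> smooth_on S f -> S p ->
  ext_differentiable S (foldr (pderiv S) (fun w => f w x y) s) p /\
  foldr (pderiv S) (fun w => f w x y) s p = foldr (pderiv S) f s p x y.
Proof.
move=> tS sf; elim: s p => [|i s IH] p Sp /=.
  split=> //; have [F dF fF] := smooth_on_ext_differentiable sf Sp.
  exists (fun w => F w x y); first exact: differentiable_comp_coord.
  by apply: filterS fF => u fF Su; rewrite fF.
have sm t := smooth_on_iter_pderiv t tS sf.
have eqS u : S u ->
    foldr (pderiv S) (fun w => f w x y) s u = foldr (pderiv S) f s u x y.
  by move=> Su; have [] := IH u Su.
have E u : S u -> pderiv S i (foldr (pderiv S) (fun w => f w x y) s) u
    = pderiv S i (foldr (pderiv S) f s) u x y.
  move=> Su; have [F dF fF] := smooth_on_ext_differentiable (sm s) Su.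
  rewrite (pderivE _ _ _ dF fF)// -derive_coord//.
  apply: pderivE => //; first exact: differentiable_comp_coord.
  by apply: filterS fF => w fF Sw; rewrite eqS// fF.
split; last exact: E.
apply: (@ext_differentiable_subset _ _ _ S S
  (fun w => pderiv S i (foldr (pderiv S) f s) w x y)) => //.
have sD := smooth_on_pderiv i tS (sm s).
have [F dF fF] := smooth_on_ext_differentiable sD Sp.
exists (fun w => F w x y); first exact: differentiable_comp_coord.
by apply: filterS fF => u fF Su; rewrite fF.
Qed.

Definition mindex_seq (m : nat) (alpha : {ffun 'I_m -> nat}) : seq 'I_m :=
  flatten [seq nseq (alpha i) i | i <- enum 'I_m].

Lemma mderivE (R : realType) (m : nat) (W : normedModType R)
    (S : set 'rV[R]_m) (alpha : {ffun 'I_m -> nat}) (f : 'rV[R]_m -> W) :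
  mderiv S alpha f = foldr (pderiv S) f (mindex_seq alpha).
Proof.
rewrite /mderiv /mindex_seq; elim: (enum 'I_m) => //= i s ->.
by rewrite foldr_cat; elim: (alpha i) => //= k ->.
Qed.

Lemma size_mindex_seq (m : nat) (alpha : {ffun 'I_m -> nat}) :
  size (mindex_seq alpha) = mindex_order alpha.
Proof.
rewrite size_flatten /shape -map_comp sumnE big_map big_enum /=.
by apply: eq_bigr => i _; rewrite size_nseq.
Qed.

Lemma perm_mindex_seq (m : nat) (s : seq 'I_m) :
  perm_eq s (mindex_seq [ffun i => count_mem i s]).
Proof.
apply/allP => i _ /=; apply/eqP.
rewrite count_flatten -map_comp sumnE big_map big_enum /=.
rewrite (bigD1 i)//= ffunE count_nseq /= eqxx mul1n big1 ?addn0// => j ji.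
by rewrite count_nseq /= (negbTE ji) mul0n.
Qed.

(** * Uniform bounds on derivatives up to a given order *)

(** One constant serves all orders. Differentiability is required below order [r], exactly where a
    further derivative is taken, so that the sum, product and chain rules apply. The recursion peels
    off the innermost derivative. *)
Fixpoint bounded_derivs (R : realType) (m : nat) (S : set 'rV[R]_m) (r : nat)
    (c : R) (h : 'rV[R]_m -> R) : Prop :=
  (forall u, S u -> `|h u| <= c) /\
  (if r is r'.+1 then
     (forall u, S u -> ext_differentiable S h u) /\
     forall i, bounded_derivs S r' c (pderiv S i h)
   else True).

Section BoundedDerivs.
Context {R : realType} {m : nat}.
Implicit Types (S : set 'rV[R]_m) (h f g : 'rV[R]_m -> R) (c : R) (r : nat).

Lemma bounded_derivs_le0 S r c h u :
  bounded_derivs S r c h -> S u -> `|h u| <= c.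
Proof. by case: r => [|r] [hc _]; exact: hc. Qed.

Lemma bounded_derivs_widen S r r' c c' h :
  (r' <= r)%N -> c <= c' -> bounded_derivs S r c h -> bounded_derivs S r' c' h.
Proof.
move=> + cc'; elim: r' r h => [|r' IH] [|r] h //=.
- by move=> _ [hc _]; split=> // u Su; rewrite (le_trans (hc u Su)).
- by move=> _ [hc _]; split=> // u Su; rewrite (le_trans (hc u Su)).
rewrite ltnS => rr' [hc [dh ih]].
split=> [u Su|]; first by rewrite (le_trans (hc u Su)).
by split=> // i; apply: IH (ih i).
Qed.

Lemma bounded_derivs_subset S S' r c f g :
  thick S -> thick S' -> S' `<=` S -> (forall u, S' u -> g u = f u) ->
  bounded_derivs S r c f -> bounded_derivs S' r c g.
Proof.
move=> tS tS' sS; elim: r f g => [|r IH] f g gf /= [fc df].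
  by split=> // u S'u; rewrite gf// fc//; exact: sS.
split=> [u S'u|]; first by rewrite gf// fc//; exact: sS.
case: df => df bf; split=> [u S'u|i].
  by apply: (ext_differentiable_subset sS gf); apply/df/sS.
by apply: IH (bf i) => u S'u; apply: pderiv_subset => //; apply/df/sS.
Qed.

Lemma eq_bounded_derivs S r c f g :
  thick S -> (forall u, S u -> g u = f u) ->
  bounded_derivs S r c f -> bounded_derivs S r c g.
Proof. by move=> tS; apply: bounded_derivs_subset. Qed.

Lemma bounded_derivs_cst S r c (a : R) :
  thick S -> `|a| <= c -> bounded_derivs S r c (fun=> a).
Proof.
move=> tS; elim: r a => [|r IH] a ac /=; split=> //; split=> [u Su|i].
  exact: ext_differentiable_cst.
apply: (@eq_bounded_derivs _ _ _ (fun=> 0)) => // [u Su|].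
  exact: pderiv_cst.
by apply: IH; rewrite normr0 (le_trans _ ac).
Qed.

Lemma bounded_derivsD S r c c' f g :
  thick S -> bounded_derivs S r c f -> bounded_derivs S r c' g ->
  bounded_derivs S r (c + c') (fun u => f u + g u).
Proof.
move=> tS; elim: r f g => [|r IH] f g /= [fc df] [gc dg].
  by split=> // u Su; rewrite (le_trans (ler_normD _ _))// lerD ?fc ?gc.
split=> [u Su|]; first by rewrite (le_trans (ler_normD _ _))// lerD ?fc ?gc.
case: df dg => [df bf] [dg bg]; split=> [u Su|i].
  by apply: ext_differentiableD; [exact: df|exact: dg].
apply: eq_bounded_derivs (IH _ _ (bf i) (bg i)) => // u Su.
by apply: pderivD; [| |exact: df|exact: dg].
Qed.

Lemma bounded_derivs_sum S r c n (f : 'I_n -> 'rV[R]_m -> R) :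
  thick S -> (forall a, bounded_derivs S r c (f a)) ->
  bounded_derivs S r (n%:R * c) (fun u => \sum_a f a u).
Proof.
move=> tS; elim: n f => [|n IH] f bf.
  apply: (@eq_bounded_derivs _ _ _ (fun=> 0)) => // [u _|].
    by rewrite big_ord0.
  by apply: bounded_derivs_cst; rewrite // normr0 mul0r.
apply: (@eq_bounded_derivs _ _ _
    (fun u => \sum_(a < n) f (widen_ord (leqnSn n) a) u + f ord_max u)) => //
    [u _|].
  by rewrite big_ord_recr.
rewrite -(natr1 n) mulrDl mul1r; apply: bounded_derivsD => //.
exact: (IH (fun a => f (widen_ord (leqnSn n) a))).
Qed.

(** Each application of the product rule doubles the number of terms, whence the factor [2 ^+ r]. *)
Lemma bounded_derivsM S r c c' f g :
  thick S -> bounded_derivs S r c f -> bounded_derivs S r c' g ->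
  bounded_derivs S r (2 ^+ r * (c * c')) (fun u => f u * g u).
Proof.
move=> tS; elim: r f g => [|r IH] f g bf bg.
  case: bf bg => [fc _] [gc _].
  by split=> // u Su; rewrite expr0 mul1r normrM ler_pM ?fc ?gc.
have fw : bounded_derivs S r c f by apply: bounded_derivs_widen bf.
have gw : bounded_derivs S r c' g by apply: bounded_derivs_widen bg.
move: bf bg => /= [fc [df bf]] [gc [dg bg]]; split=> [u Su|].
  have cc0 : 0 <= c * c'.
    by rewrite mulr_ge0// (le_trans _ (fc u Su), le_trans _ (gc u Su)).
  rewrite normrM (@le_trans _ _ (c * c'))//; first by rewrite ler_pM ?fc ?gc.
  by rewrite ler_peMl// exprn_ege1// ler1n.
split=> [u Su|i].
  by apply: ext_differentiableM; [exact: df|exact: dg].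
have := bounded_derivsD tS (IH _ _ fw (bg i)) (IH _ _ (bf i) gw).
have -> : 2 ^+ r * (c * c') + 2 ^+ r * (c * c') = 2 ^+ r.+1 * (c * c').
  by rewrite exprS; ring.
apply: eq_bounded_derivs => // u Su.
rewrite pderivM//; [|exact: df|exact: dg].
by rewrite [g u * _]mulrC.
Qed.

Lemma bounded_derivsP S r c h :
  bounded_derivs S r c h <->
  forall s : seq 'I_m, (size s <= r)%N -> forall u, S u ->
    `|foldr (pderiv S) h s u| <= c /\
    ((size s < r)%N -> ext_differentiable S (foldr (pderiv S) h s) u).
Proof.
split.
  elim: r h => [|r IH] h /=.
    by move=> [hc _] [|//] _ u Su; split=> //; exact: hc.
  (* The last entry of the sequence is the derivative applied first, which is the one that the
     recursion peels off. *)
  move=> [hc [dh bh]]; elim/last_ind => [|s i _] /=.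
    by move=> _ u Su; split=> [|_]; [exact: hc|exact: dh].
  by rewrite size_rcons foldr_rcons !ltnS => sr u Su; exact: (IH _ (bh i)).
elim: r h => [|r IH] h H /=.
  by split=> // u Su; have [] := H [::] isT u Su.
split=> [u Su|]; first by have [] := H [::] isT u Su.
split=> [u Su|i]; first by have [_] := H [::] isT u Su; exact.
apply: IH => s sr u Su; have := H (rcons s i).
rewrite size_rcons foldr_rcons !ltnS.
by move/(_ sr u Su).
Qed.

End BoundedDerivs.

(** The chain rule turns a derivative of [G \o f] into a sum of products of entries of the Jacobian
    with partial derivatives of [G] composed with [f]; the induction hypothesis applies to the
    latter. *)
Lemma bounded_derivs_comp (R : realType) (m n r : nat) (C D : R) :
  0 <= C -> 0 <= D -> exists2 c, 0 <= c &
  forall (S : set 'rV[R]_m) (S' : set 'rV[R]_n) (f : 'rV[R]_m -> 'rV[R]_n)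
    (G : 'rV[R]_n -> R),
    thick S -> thick S' -> (forall u, S u -> S' (f u)) ->
    (forall u, S u -> ext_differentiable S f u) ->
    (forall i a, bounded_derivs S r D (fun u => pderiv S i f u 0 a)) ->
    bounded_derivs S' r C G -> bounded_derivs S r c (fun u => G (f u)).
Proof.
move=> C0 D0; elim: r => [|r [c c0 IH]].
  by exists C => // S S' f G _ _ fS _ _ [GC _]; split=> // u Su; exact/GC/fS.
have c'0 : 0 <= n%:R * (2 ^+ r * (D * c)) by rewrite !mulr_ge0// exprn_ge0.
exists (C + n%:R * (2 ^+ r * (D * c))); first exact: addr_ge0.
move=> S S' f G tS tS' fS df bdf [GC [dG bG]]; split=> [u Su|].
  by rewrite (le_trans (GC _ (fS _ Su)))// lerDl.
split=> [u Su|i].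
  by apply: (ext_differentiable_comp fS Su (df u Su)); apply/dG/fS.
apply: (@bounded_derivs_widen _ _ _ r _ (n%:R * (2 ^+ r * (D * c)))) => //.
  by rewrite lerDr.
pose K u := \sum_a pderiv S i f u 0 a * pderiv S' a G (f u).
apply: (@eq_bounded_derivs _ _ _ _ _ K) => // [u Su|].
  by rewrite (pderiv_comp _ tS tS' fS Su (df u Su) (dG _ (fS _ Su))).
apply: bounded_derivs_sum => // a; apply: bounded_derivsM => //.
  exact: bounded_derivs_widen (bdf i a).
apply: (IH S S') => // [j b|]; last exact: bG.
exact: bounded_derivs_widen (bdf j b).
Qed.

(** * Derivatives of the inverse matrix *)

Lemma differentiable_det (R : realType) (V : normedModType R) (n : nat)
    (F : V -> 'M[R]_n) (p : V) :
  (forall i j, differentiable (fun w => F w i j) p) ->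
  differentiable (fun w => \det (F w)) p.
Proof.
move=> dF; rewrite /determinant.
have dprod (s : 'I_n -> 'I_n) (t : seq 'I_n) :
    differentiable (fun w => \prod_(i <- t) F w i (s i)) p.
  elim: t => [|i t IH].
    by under eq_fun do rewrite big_nil; exact: differentiable_cst.
  by under eq_fun do rewrite big_cons; exact: differentiableM.
elim: (index_enum _) => [|s t IH].
  by under eq_fun do rewrite big_nil; exact: differentiable_cst.
under eq_fun do rewrite big_cons.
by apply: differentiableD => //; apply: differentiableM.
Qed.

(** [G] is the cofactor formula, defined everywhere. [invmx] returns a singular matrix unchanged, so
    the two are compared at invertible values only. *)
Lemma differentiable_invmx (R : realType) (V : normedModType R) (n : nat)
    (F : V -> 'M[R]_n) (p : V) (i j : 'I_n) :
  (forall i j, differentiable (fun w => F w i j) p) -> F p \in unitmx ->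
  exists2 G : V -> R, differentiable G p &
    forall w, F w \in unitmx -> invmx (F w) i j = G w.
Proof.
move=> dF uF; exists (fun w => (\det (F w))^-1 * cofactor (F w) j i).
  apply: differentiableM.
    apply: differentiableV; first exact: differentiable_det.
    by rewrite -unitfE -unitmxE.
  apply: differentiableM; first exact: differentiable_cst.
  by apply: differentiable_det => a b; under eq_fun do rewrite !mxE.
by move=> w uw; rewrite /invmx uw !mxE.
Qed.

Section InverseMatrix.
Context {R : realType} {m n : nat}.
Implicit Types (S : set 'rV[R]_m) (g : 'rV[R]_m -> 'M[R]_n).

Lemma ext_differentiable_invmx S g p i j :
  (forall u, S u -> g u \in unitmx) -> S p ->
  (forall i j, ext_differentiable S (fun u => g u i j) p) ->
  ext_differentiable S (fun u => invmx (g u) i j) p.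
Proof.
move=> ug Sp dg.
(* Every entry comes with its own extension; choice collects them into one matrix, and the finitely
   many neighbourhoods are intersected. *)
pose FP a b := cid2 (dg a b).
pose F u : 'M[R]_n := \matrix_(a, b) s2val (FP a b) u.
have dF a b : differentiable (fun u => F u a b) p.
  by under eq_fun do rewrite mxE; exact: (s2valP (FP a b)).
have gF : \forall u \near p, S u -> g u = F u.
  have nE a b : \forall u \near p, S u -> g u a b = F u a b.
    by apply: filterS (s2valP' (FP a b)) => u; rewrite mxE.
  have nE' a : \forall u \near p, forall b, S u -> g u a b = F u a b.
    exact: (@filter_forall _ _ (fun b u => S u -> g u a b = F u a b)
      (nbhs p) (nbhs_filter p) (nE a)).
  have nF := @filter_forall _ _
    (fun a u => forall b, S u -> g u a b = F u a b) (nbhs p) (nbhs_filter p) nE'.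
  by apply: filterS nF => u E Su; apply/matrixP => a b; exact: E.
have uF : F p \in unitmx by rewrite -(nbhs_singleton gF)// ug.
have [G dG GE] := differentiable_invmx i j dF uF.
exists G => //; apply: filterS gF => u gF Su.
by rewrite gF// GE// -gF// ug.
Qed.

(** Differentiate [g^-1 g = 1]. The sign is a factor [-1], so that the right-hand side consists of
    sums and products, the shapes for which bounds are available. *)
Lemma pderiv_invmx S g p k i j :
  thick S -> (forall u, S u -> g u \in unitmx) -> S p ->
  (forall i j, ext_differentiable S (fun u => g u i j) p) ->
  pderiv S k (fun u => invmx (g u) i j) p =
  \sum_a \sum_b -1 * (invmx (g p) i a *
    (pderiv S k (fun u => g u a b) p * invmx (g p) b j)).
Proof.
move=> tS ug Sp dg.
pose dI : 'M[R]_n := \matrix_(i, j) pderiv S k (fun u => invmx (g u) i j) p.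
pose dG : 'M[R]_n := \matrix_(i, j) pderiv S k (fun u => g u i j) p.
have dinv a b := ext_differentiable_invmx a b ug Sp dg.
have E : dI *m g p + invmx (g p) *m dG = 0.
  apply/matrixP => x y; rewrite !mxE -big_split /=.
  transitivity (pderiv S k (fun u => \sum_a invmx (g u) x a * g u a y) p).
    rewrite pderiv_sum// => [|a]; last exact: ext_differentiableM.
    apply: eq_bigr => a _; rewrite !mxE pderivM//.
    by rewrite addrC [_ * g p a y]mulrC.
  apply: etrans _ (pderiv_cst ((1%:M : 'M[R]_n) x y) k tS Sp).
  apply: pderiv_subset => // [u Su|].
    by rewrite -(mulVmx (ug u Su)) mxE.
  exact: ext_differentiable_cst.
have -> : pderiv S k (fun u => invmx (g u) i j) p = dI i j by rewrite mxE.
have -> : dI = - (invmx (g p) *m (dG *m invmx (g p))).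
  move/eqP: E; rewrite addr_eq0 => /eqP E.
  by rewrite -(mulmxK (ug p Sp) dI) E mulNmx mulmxA.
rewrite !mxE -sumrN; apply: eq_bigr => a _; rewrite !mxE.
rewrite mulr_sumr -sumrN; apply: eq_bigr => b _.
by rewrite !mxE mulN1r.
Qed.

(** The derivative of the inverse contains the inverse only undifferentiated, so its bound at order
    0 propagates to all orders. *)
Lemma bounded_derivs_invmx r (C : R) : 0 <= C -> exists2 c, 0 <= c &
  forall S g, thick S -> (forall u, S u -> g u \in unitmx) ->
    (forall i j, bounded_derivs S r C (fun u => g u i j)) ->
    (forall u i j, S u -> `|invmx (g u) i j| <= C) ->
    forall i j, bounded_derivs S r c (fun u => invmx (g u) i j).
Proof.
move=> C0; elim: r => [|r [c c0 IH]].
  by exists C => // S g _ _ _ gC i j; split=> // u Su; exact: gC.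
(* The sums and the four factors of the formula for the derivative, with [2 ^+ r] for each
   product. *)
pose c' := n%:R * (n%:R * (2 ^+ r * (1 * (2 ^+ r * (c * (2 ^+ r * (C * c))))))).
have c'0 : 0 <= c' by rewrite !mulr_ge0// exprn_ge0.
exists (C + c'); first exact: addr_ge0.
move=> S g tS ug bg gC i j; split=> [u Su|].
  by rewrite (le_trans (gC u i j Su))// lerDl.
have dg u a b : S u -> ext_differentiable S (fun u => g u a b) u.
  by move=> Su; case: (bg a b) => _ [+ _]; exact.
have bg' a b : bounded_derivs S r C (fun u => g u a b).
  exact: bounded_derivs_widen (bg a b).
have {}IH a b := IH S g tS ug bg' gC a b.
split=> [u Su|k]; first by apply: ext_differentiable_invmx => // a b; exact: dg.
apply: (@bounded_derivs_widen _ _ _ r _ c') => //; first by rewrite lerDr.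
have E u Su := pderiv_invmx k i j tS ug Su (fun a b => dg u a b Su).
apply: (eq_bounded_derivs tS E).
apply: bounded_derivs_sum => // a; apply: bounded_derivs_sum => // b.
apply: bounded_derivsM => //.
  by apply: bounded_derivs_cst; rewrite // normrN1.
apply: bounded_derivsM => //; apply: bounded_derivsM => //.
by case: (bg a b) => _ [_ +]; exact.
Qed.

End InverseMatrix.

(** * Positive definite matrices *)

Lemma pos_def_ge0 (R : realType) (m : nat) (G : 'M[R]_m) (v : 'rV[R]_m) :
  pos_def G -> 0 <= (v *m G *m v^T) 0 0.
Proof.
move=> [_ pG]; have [->|v0] := eqVneq v 0; first by rewrite !mul0mx mxE.
exact/ltW/pG.
Qed.

Lemma pos_def_unitmx (R : realType) (m : nat) (G : 'M[R]_m) :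
  pos_def G -> G \in unitmx.
Proof.
move=> [_ pG]; rewrite -row_free_unit -kermx_eq0; apply/eqP/row_matrixP => i.
apply/eqP; rewrite row0; apply/negPn/negP => /pG.
by rewrite -row_mul mulmx_ker row0 mul0mx mxE ltxx.
Qed.

(* Expand [0 <= w G w^T] for [w = v - (v G^-1) / (m C)]. *)
Lemma pos_def_coord_bound (R : realType) (m : nat) (G : 'M[R]_m) (C : R)
    (v : 'rV[R]_m) (a : 'I_m) :
  0 < C -> pos_def G -> (forall i j, `|invmx G i j| <= C) ->
  (v *m G *m v^T) 0 0 <= C -> `|v 0 a| <= m%:R * C.
Proof.
move=> C0 pG iG vC.
have m0 : 0 < m%:R :> R by rewrite ltr0n; case: m a {G v pG iG vC} => [[]|].
have mC0 : 0 < m%:R * C by rewrite mulr_gt0.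
pose q := (v *m v^T) 0 0; pose s := (v *m invmx G *m v^T) 0 0.
have qE : q = \sum_b v 0 b ^+ 2.
  by rewrite /q mxE; apply: eq_bigr => b _; rewrite mxE expr2.
(* Entrywise bounds and [2xy <= x^2 + y^2]: the eigenvalues of the inverse are at most [m C]. *)
have sq : s <= m%:R * C * q.
  have -> : s = \sum_b \sum_c v 0 b * invmx G b c * v 0 c.
    rewrite /s mxE exchange_big /=; apply: eq_bigr => c _.
    by rewrite !mxE mulr_suml.
  apply: (@le_trans _ _ (\sum_b \sum_c C / 2 * (v 0 b ^+ 2 + v 0 c ^+ 2))).
    apply: ler_sum => b _; apply: ler_sum => c _.
    apply: le_trans (ler_norm _) _; rewrite !normrM.
    apply: (@le_trans _ _ (C * (`|v 0 b| * `|v 0 c|))).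
      by rewrite mulrAC mulrC ler_wpM2r.
    rewrite -mulrA ler_pM2l// -(real_normK (num_real (v 0 b))).
    rewrite -(real_normK (num_real (v 0 c))).
    by have := sqr_ge0 (`|v 0 b| - `|v 0 c|); nra.
  under eq_bigr do rewrite -mulr_sumr big_split /= sumr_const card_ord -qE.
  rewrite -mulr_sumr big_split /= sumrMnl -qE sumr_const card_ord.
  rewrite -[q *+ m]mulr_natl.
  by rewrite le_eqVlt; apply/orP; left; apply/eqP; field.
(* With this [t] the quadratic term [t ^+ 2 * s] is at most [t * q], so the expansion leaves
   [t * q <= C]. *)
pose t := (m%:R * C)^-1; pose w := v - t *: (v *m invmx G).
have uG := pos_def_unitmx pG; have [GT _] := pG.
have := pos_def_ge0 w pG.
have -> : (w *m G *m w^T) 0 0 = (v *m G *m v^T) 0 0 - 2 * t * q + t ^+ 2 * s.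
  have -> : w *m G = v *m G - t *: v.
    by rewrite mulmxBl -scalemxAl mulmxKV.
  have -> : w^T = v^T - t *: (invmx G *m v^T).
    by rewrite linearB linearZ /= trmx_mul trmx_inv GT.
  rewrite mulmxBl !mulmxBr -!scalemxAr -!scalemxAl.
  rewrite (mulmxA _ (invmx G)) mulmxK// (mulmxA v (invmx G)).
  rewrite /q /s; move: (v *m G *m v^T) (v *m v^T) (v *m invmx G *m v^T).
  by move=> X Y Z; rewrite !mxE; ring.
move=> h.
have tE : t * (m%:R * C) = 1 by rewrite mulVf// gt_eqF.
have t0 : 0 < t by rewrite invr_gt0.
have qC : q <= (m%:R * C) * C.
  have : t * q <= C.
    have : t ^+ 2 * s <= t * q.
      rewrite expr2 -mulrA ler_pM2l// -[leRHS]mul1r -tE -mulrA ler_pM2l//.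
    lra.
  by move=> tq; rewrite -(ler_pM2l t0) mulrA tE mul1r.
have vq : v 0 a ^+ 2 <= q.
  by rewrite qE (bigD1 a)//= lerDl sumr_ge0// => b _; exact: sqr_ge0.
rewrite -(@ler_pXn2r _ 2)// ?nnegrE// ?(ltW mC0)//.
rewrite real_normK ?num_real// (le_trans vq)// (le_trans qC)//.
rewrite expr2 ler_pM2l// ler_peMl// ?(ltW C0)//.
by rewrite ler1n -(ltr0n R).
Qed.

(** * Isometries between subsets of Euclidean space *)

Definition jacobian_on (R : realType) (m : nat) (S : set 'rV[R]_m)
    (f : 'rV[R]_m -> 'rV[R]_m) (u : 'rV[R]_m) : 'M[R]_m :=
  \matrix_(i, a) pderiv S i f u 0 a.

(** What the estimates retain of two charts and their transition. [S'] is the whole target domain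
    rather than the image of [f], so the bounds on [g'] do not refer to [f]. *)
Record bounded_isometry (R : realType) (m : nat) (S S' : set 'rV[R]_m)
    (f : 'rV[R]_m -> 'rV[R]_m) (g g' : 'rV[R]_m -> 'M[R]_m) (r : nat) (C : R) :
    Prop := BoundedIsometry {
  bi_thick : thick S ;
  bi_thick' : thick S' ;
  bi_maps : forall u, S u -> S' (f u) ;
  bi_smooth : smooth_on S f ;
  bi_pos : forall u, S u -> pos_def (g u) ;
  bi_pos' : forall u, S' u -> pos_def (g' u) ;
  bi_bound : forall i j, bounded_derivs S r C (fun u => g u i j) ;
  bi_bound' : forall i j, bounded_derivs S' r C (fun u => g' u i j) ;
  bi_inv : forall u i j, S u -> `|invmx (g u) i j| <= C ;
  bi_inv' : forall u i j, S' u -> `|invmx (g' u) i j| <= C ;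
  bi_isometry : forall u, S u ->
    g u = jacobian_on S f u *m g' (f u) *m (jacobian_on S f u)^T
}.

(* The derivative [d_l g_ij] minus the part of [d_l (J g' J^T)_ij] in which
   [d_l] falls on the coefficients of [g']. *)
Definition metric_deriv_defect (R : realType) (m : nat) (S S' : set 'rV[R]_m)
    (f : 'rV[R]_m -> 'rV[R]_m) (g g' : 'rV[R]_m -> 'M[R]_m) (l i j : 'I_m)
    (u : 'rV[R]_m) : R :=
  pderiv S l (fun w => g w i j) u + -1 * \sum_a \sum_b
    pderiv S i f u 0 a * (pderiv S j f u 0 b *
      \sum_c pderiv S l f u 0 c * pderiv S' c (fun w => g' w a b) (f u)).

Section Isometry.
Context {R : realType} {m : nat} (S S' : set 'rV[R]_m)
  (f : 'rV[R]_m -> 'rV[R]_m) (g g' : 'rV[R]_m -> 'M[R]_m).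

Let J i a u := pderiv S i f u 0 a.

(** The diagonal of the isometry identity: row [i] of the Jacobian has squared [g']-length [g_ii],
    at most [C]. *)
Lemma isometry_jacobian_bound r (C : R) :
  0 < C -> bounded_isometry S S' f g g' r C ->
  forall i a, bounded_derivs S 0 (m%:R * C) (J i a).
Proof.
move=> C0 B i a; split=> // u Su; have S'fu := bi_maps B Su.
have -> : J i a u = row i (jacobian_on S f u) 0 a by rewrite !mxE.
apply: (pos_def_coord_bound (G := g' (f u))) => //; first exact: (bi_pos' B).
  by move=> x y; exact: (bi_inv' B).
rewrite -row_mul; set Ju := jacobian_on S f u.
have -> : (row i (Ju *m g' (f u)) *m (row i Ju)^T) 0 0 = g u i i.
  rewrite (bi_isometry B Su) !mxE; apply: eq_bigr => b _.
  by rewrite !mxE.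
exact: le_trans (ler_norm _) (bounded_derivs_le0 (bi_bound B i i) Su).
Qed.

Let A := metric_deriv_defect S S' f g g'.

Lemma isometry_jacobian_diff r C i a u : bounded_isometry S S' f g g' r C ->
  S u -> ext_differentiable S (J i a) u.
Proof.
move=> B Su; have sJ := smooth_on_pderiv i (bi_thick B) (bi_smooth B).
by have [] := iter_pderiv_coord 0 a [::] (bi_thick B) sJ Su.
Qed.

Lemma isometry_hessian_sym r C l i a u : bounded_isometry S S' f g g' r C ->
  S u -> pderiv S l (J i a) u = pderiv S i (J l a) u.
Proof.
move=> B Su; have tS := bi_thick B; have sf := bi_smooth B.
have E x y : pderiv S x (J y a) u = pderiv S x (pderiv S y f) u 0 a.
  by have [] := iter_pderiv_coord 0 a [:: x] tS (smooth_on_pderiv y tS sf) Su.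
by rewrite E E (pderiv_comm l i tS sf Su).
Qed.

(* The classical derivation of the Christoffel symbols: with
   [T l i j = g'(d_l d_i f, d_j f)], differentiating [g = J g' J^T] gives
   [A l i j = T l i j + T l j i], and [T] is symmetric in [l] and [i]. *)
Lemma isometry_hessian r C l i a u : bounded_isometry S S' f g g' r.+1 C ->
  S u -> pderiv S l (J i a) u =
  \sum_j 2^-1 * (A l i j u + (A i l j u + -1 * A j l i u)) *
    \sum_b invmx (g u) j b * J b a u.
Proof.
move=> B Su; have tS := bi_thick B; have tS' := bi_thick' B.
pose h a b w := g' (f w) a b.
pose H l i a := pderiv S l (J i a) u.
pose T l i j := \sum_a \sum_b H l i a * (h a b u * J j b u).
have dJ x y : ext_differentiable S (J x y) u.
  exact: (isometry_jacobian_diff _ _ B Su).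
have df : ext_differentiable S f u.
  exact: smooth_on_ext_differentiable (bi_smooth B) Su.
have dg' x y : ext_differentiable S' (fun w => g' w x y) (f u).
  by have [_ [+ _]] := bi_bound' B x y; apply; exact: (bi_maps B Su).
have dh x y : ext_differentiable S (h x y) u.
  exact: (ext_differentiable_comp (G := fun w => g' w x y) (bi_maps B) Su df).
have hsym x y : h x y u = h y x u.
  by have [+ _] := bi_pos' B (bi_maps B Su); rewrite /h => {1}<-; rewrite mxE.
have TS x y z : T x y z = T y x z.
  apply: eq_bigr => b _; apply: eq_bigr => c _.
  by rewrite /H (isometry_hessian_sym _ _ _ B Su).
have AT x y z : A x y z u = T x y z + T x z y.
  have dprod b c :
      ext_differentiable S (fun w => J y b w * (h b c w * J z c w)) u.
    by apply: ext_differentiableM => //; apply: ext_differentiableM.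
  have dsum b :
      ext_differentiable S (fun w => \sum_c J y b w * (h b c w * J z c w)) u.
    exact: ext_differentiable_sum.
  have E : pderiv S x (fun w => g w y z) u =
      pderiv S x (fun w => \sum_b \sum_c J y b w * (h b c w * J z c w)) u.
    apply: pderiv_subset => // [w Sw|]; last exact: ext_differentiable_sum.
    rewrite (bi_isometry B Sw) -mulmxA mxE; apply: eq_bigr => b _.
    rewrite !mxE mulr_sumr; apply: eq_bigr => c _.
    by rewrite !mxE.
  rewrite /A /metric_deriv_defect E (pderiv_sum _ _ tS Su dsum) mulN1r.
  rewrite -sumrB /T [X in _ = _ + X]exchange_big /=.
  rewrite -big_split /=; apply: eq_bigr => b _.
  rewrite (pderiv_sum _ _ tS Su (dprod b)) -sumrB -big_split /=.
  apply: eq_bigr => c _.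
  rewrite pderivM//; last exact: ext_differentiableM.
  rewrite pderivM//.
  have -> : pderiv S x (h b c) u
      = \sum_e J x e u * pderiv S' e (fun w => g' w b c) (f u).
    exact: (pderiv_comp (G := fun w => g' w b c) x tS tS' (bi_maps B) Su df).
  by rewrite /H (hsym c b) /J; ring.
(* The Koszul combination: by the symmetry of [T] four of the six terms cancel and the other two
   agree. *)
have TE x y z : 2^-1 * (A x y z u + (A y x z u + -1 * A z x y u)) = T x y z.
  rewrite !AT (TS x z y) (TS y x z) (TS y z x).
  by move: (T x y z) (T x z y) (T z y x) => a1 a2 a3; field.
under eq_bigr do rewrite TE.
pose Jm := jacobian_on S f u; pose N := g' (f u) *m Jm^T.
pose Hr : 'rV[R]_m := \row_b H l i b.
(* [T l i] is the Hessian row times [N]. The isometry identity exhibits the inverse of [N] as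
   [g^-1 J], whose factors are already bounded. *)
have NE : N *m (invmx (g u) *m Jm) = 1%:M.
  apply: mulmx1C; rewrite -mulmxA /N (mulmxA Jm) -(bi_isometry B Su).
  exact/mulVmx/pos_def_unitmx/(bi_pos B).
have -> : pderiv S l (J i a) u = Hr 0 a by rewrite mxE.
rewrite -[Hr]mulmx1 -NE mulmxA mxE; apply: eq_bigr => j _; congr (_ * _).
  rewrite /T /N mxE; apply: eq_bigr => b _; rewrite !mxE mulr_sumr.
  by apply: eq_bigr => c _; rewrite !mxE.
by rewrite mxE; apply: eq_bigr => b _; rewrite mxE.
Qed.

End Isometry.

Lemma bounded_isometry_widen (R : realType) (m : nat) (S S' : set 'rV[R]_m)
    (f : 'rV[R]_m -> 'rV[R]_m) (g g' : 'rV[R]_m -> 'M[R]_m) r r' (C : R) :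
  (r' <= r)%N -> bounded_isometry S S' f g g' r C ->
  bounded_isometry S S' f g g' r' C.
Proof.
by move=> rr' [? ? ? ? ? ? b b' ? ? ?]; split=> // i j;
  [exact: bounded_derivs_widen (b i j)|exact: bounded_derivs_widen (b' i j)].
Qed.

Lemma isometry_jacobian_bounded_derivs (R : realType) (m r : nat) (C : R) :
  0 < C -> exists2 D, 0 <= D &
  forall S S' (f : 'rV[R]_m -> 'rV[R]_m) g g',
    bounded_isometry S S' f g g' r C ->
    forall i a, bounded_derivs S r D (fun u => pderiv S i f u 0 a).
Proof.
move=> C0; have C0' := ltW C0; elim: r => [|r [D D0 IH]].
  exists (m%:R * C); first by rewrite mulr_ge0.
  by move=> S S' f g g' B i a; exact: (isometry_jacobian_bound C0 B).
have [Cc Cc0 compB] := bounded_derivs_comp m m r C0' D0.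
have [Ci Ci0 invB] := @bounded_derivs_invmx R m m r C C0'.
(* [M] is the constant of a product at order [r]. [E] and [F] copy the shapes of
   [metric_deriv_defect] and of the Hessian formula; [D + F] then covers [J] and its derivatives. *)
pose M (a b : R) : R := 2 ^+ r * (a * b).
have M0 a b : 0 <= a -> 0 <= b -> 0 <= M a b.
  by move=> a0 b0; rewrite !mulr_ge0// exprn_ge0.
pose E := C + M 1 (m%:R * (m%:R * M D (M D (m%:R * M D Cc)))).
pose F := m%:R * M (M 2^-1 (E + (E + M 1 E))) (m%:R * M Ci D).
have S0 (a : R) : 0 <= a -> 0 <= m%:R * a by move=> a0; rewrite mulr_ge0.
have E0 : 0 <= E by rewrite addr_ge0 ?M0 ?S0 ?M0 ?S0 ?M0.
have F0 : 0 <= F.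
  have EE : 0 <= E + (E + M 1 E).
    by apply: addr_ge0 => //; apply: addr_ge0 => //; exact: M0.
  have CD : 0 <= m%:R * M Ci D by rewrite S0// M0.
  by rewrite S0// M0// M0// invr_ge0.
exists (D + F); first exact: addr_ge0.
move=> S S' f g g' B i a.
have B' := bounded_isometry_widen (leqnSn r) B.
have tS := bi_thick B; have tS' := bi_thick' B.
have bJ x y := IH _ _ _ _ _ B' x y.
split=> [u Su|].
  by rewrite (le_trans (bounded_derivs_le0 (bJ i a) Su))// lerDl.
split=> [u Su|l]; first exact: (isometry_jacobian_diff _ _ B Su).
apply: (@bounded_derivs_widen _ _ _ r _ F) => //; first by rewrite lerDr.
have HE u Su := isometry_hessian l i a B (u := u) Su.
apply: (eq_bounded_derivs tS HE).
have bA x y z : bounded_derivs S r E (metric_deriv_defect S S' f g g' x y z).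
  apply: bounded_derivsD => //.
    by have [_ [_ +]] := bi_bound B y z; exact.
  apply: bounded_derivsM => //.
    by apply: bounded_derivs_cst; rewrite // normrN1.
  apply: bounded_derivs_sum => // b; apply: bounded_derivs_sum => // c.
  apply: bounded_derivsM => //; apply: bounded_derivsM => //.
  apply: bounded_derivs_sum => // d; apply: bounded_derivsM => //.
  apply: (compB S S' f (pderiv S' d (fun w => g' w b c))) => //.
  - exact: (bi_maps B).
  - by move=> u; exact: (smooth_on_ext_differentiable (bi_smooth B)).
  - by have [_ [_ +]] := bi_bound' B b c; exact.
apply: bounded_derivs_sum => // j; apply: bounded_derivsM => //.
  apply: bounded_derivsM => //.
    by apply: bounded_derivs_cst; rewrite // ger0_norm ?invr_ge0.
  apply: bounded_derivsD => //; apply: bounded_derivsD => //.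
  apply: bounded_derivsM => //.
  by apply: bounded_derivs_cst; rewrite // normrN1.
apply: bounded_derivs_sum => // b; apply: bounded_derivsM => //.
apply: invB => //.
- by move=> u Su; exact/pos_def_unitmx/(bi_pos B).
- by move=> x y; exact: (bi_bound B').
- by move=> u x y; exact: (bi_inv B).
Qed.

Lemma isometry_bounded_derivs (R : realType) (m r : nat) (C L : R) :
  0 < C -> 0 <= L -> exists2 D, 0 <= D &
  forall S S' (f : 'rV[R]_m -> 'rV[R]_m) g g',
    bounded_isometry S S' f g g' r C ->
    (forall u a, S' u -> `|u 0 a| <= L) ->
    forall a, bounded_derivs S r D (fun u => f u 0 a).
Proof.
move=> C0 L0; have [D D0 JB] := isometry_jacobian_bounded_derivs m r C0.
exists (L + D); first exact: addr_ge0.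
move=> S S' f g g' B fL a; have tS := bi_thick B; have sf := bi_smooth B.
have f0 u : S u -> `|f u 0 a| <= L + D.
  by move=> Su; rewrite (le_trans (fL _ a (bi_maps B Su)))// lerDl.
case: r B JB => [|r] B JB; split=> //; split=> [u Su|i].
  by have [] := iter_pderiv_coord 0 a [::] tS sf Su.
apply: (@bounded_derivs_widen _ _ _ r.+1 _ D) => //; first by rewrite lerDr.
have E u Su := proj2 (iter_pderiv_coord 0 a [:: i] tS sf (p := u) Su).
exact: (eq_bounded_derivs tS E (JB _ _ _ _ _ B i a)).
Qed.

(** * Normal charts and their transitions *)

Lemma iter_pderiv_bounded (R : realType) (m a b : nat) (S : set 'rV[R]_m)
    (f : 'rV[R]_m -> 'M[R]_(a, b)) (x : 'I_a) (y : 'I_b) (r : nat) (c : R) :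
  thick S -> smooth_on S f ->
  (forall alpha : {ffun 'I_m -> nat}, (mindex_order alpha <= r)%N ->
   forall u, S u -> `|mderiv S alpha (fun w => f w x y) u| <= c) ->
  bounded_derivs S r c (fun w => f w x y).
Proof.
move=> tS sf fc; apply/bounded_derivsP => s sr u Su.
have [df E] := iter_pderiv_coord x y s tS sf Su; split=> //.
pose alpha := [ffun i => count_mem i s].
have ps : perm_eq s (mindex_seq alpha) by exact: perm_mindex_seq.
have := fc alpha; rewrite mderivE -size_mindex_seq -(perm_size ps).
move=> /(_ sr u Su); rewrite E (iter_pderiv_perm tS sf Su ps).
by have [_ ->] := iter_pderiv_coord x y (mindex_seq alpha) tS sf Su.
Qed.

Lemma ler_enorm (R : realType) (m : nat) (v : 'rV[R]_m) (a : 'I_m) :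
  `|v 0 a| <= enorm v.
Proof.
rewrite /enorm -sqrtr_sqr ler_wsqrtr// (bigD1 a)//= lerDl sumr_ge0// => b _.
exact: sqr_ge0.
Qed.

Lemma enorm_le (R : realType) (m : nat) (v : 'rV[R]_m) (c : R) :
  0 <= c -> (forall a, `|v 0 a| <= c) -> enorm v <= m%:R * c.
Proof.
move=> c0 vc; have mc0 : 0 <= m%:R * c by rewrite mulr_ge0.
rewrite /enorm -(ger0_norm mc0) -sqrtr_sqr ler_wsqrtr//.
apply: (@le_trans _ _ (\sum_(a < m) c ^+ 2)).
  apply: ler_sum => a _; rewrite -(real_normK (num_real (v 0 a))).
  by rewrite lerXn2r ?nnegrE.
rewrite sumr_const card_ord -[c ^+ 2 *+ m]mulr_natl exprMn ler_wpM2r ?sqr_ge0//.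
by rewrite -natrX ler_nat; case: m {v vc mc0} => // m; rewrite expnS leq_pmulr.
Qed.

(** The sum of the three radii covers collar and Gaussian charts alike; it provides the bound on the
    transition itself. *)
Lemma normal_chart_dom (R : realType) (M : Type) (n : nat)
    (A : set (rchart R M n.+1)) (R1 R2 R3 : R) (kappa : rchart R M n.+1) :
  0 < R1 -> 0 < R2 -> 0 < R3 -> normal_chart A R1 R2 R3 kappa ->
  chart_for A kappa /\
  forall u a, cdom kappa u -> `|u 0 a| <= R1 + R2 + R3.
Proof.
move=> R10 R20 R30 [[r1 [r2 [/andP[r10 r1R] /andP[r20 r2R] [ck dk _]]]]|].
  split=> // u a; rewrite dk => -[v [t [-> /= vr /andP[t0 tr]]]].
  rewrite mxE; case: unliftP => [b _|_].
    by have := ler_enorm v b; move: vr; rewrite /eball /=; lra.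
  by rewrite ger0_norm//; lra.
move=> [r3 /andP[r30 r3R] [phi [p [E [_ _ _ _ [ck dk _]]]]]].
split=> // u a; rewrite dk /eball /= => ur.
by have := ler_enorm u a; lra.
Qed.

Lemma thick_rel_open (R : realType) (m : nat) (S U : set 'rV[R]_m) :
  open S \/ rel_open (half_space R m) S -> rel_open S U -> thick U.
Proof.
move=> oS [V oV ->]; apply: thick_open; case: oS => [oS|[W oW ->]].
  by left; exact: openI.
by right; exists (W `&` V); [exact: openI|rewrite setIA].
Qed.

Lemma transition_dom (R : realType) (M : Type) (m : nat)
    (phi psi : rchart R M m) (u : 'rV[R]_m) :
  overlap phi psi u -> cdom psi (transition phi psi u).
Proof.
move=> [_ [v dv vu]]; rewrite /transition.
by have [] := @xgetPex _ 0 [set v | cdom psi v /\ cmap psi v = cmap phi u]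
  (ex_intro _ v (conj dv vu)).
Qed.

Lemma normal_transition_isometry (R : realType) (n k : nat) (R1 R2 R3 C : R)
    (M : topologicalType) (A : set (rchart R M n.+1))
    (kappa1 kappa2 : rchart R M n.+1) :
  0 < R1 -> 0 < R2 -> 0 < R3 ->
  riemannian_manifold A -> metric_bound A R1 R2 R3 k C ->
  normal_chart A R1 R2 R3 kappa1 -> normal_chart A R1 R2 R3 kappa2 ->
  bounded_isometry (overlap kappa2 kappa1) (cdom kappa1)
    (transition kappa2 kappa1) (gram kappa2) (gram kappa1) k C.
Proof.
move=> R10 R20 R30 [_ _ _ maxA] mb n1 n2.
have [c1 _] := normal_chart_dom R10 R20 R30 n1.
have [c2 _] := normal_chart_dom R10 R20 R30 n2.
(* By maximality [kappa1] belongs to [A], so [kappa2], a chart for [A], is compatible with it. *)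
have [[[oS _] sT _ iso] _] := c2.2 _ ((maxA kappa1).2 c1).
have [[dom1o _ s1 p1] _] := c1; have [[dom2o _ s2 p2] _] := c2.
have t1 := thick_open dom1o; have t2 := thick_open dom2o.
have tS := thick_rel_open dom2o oS.
have S2 : overlap kappa2 kappa1 `<=` cdom kappa2 by move=> u [].
have inv kappa : normal_chart A R1 R2 R3 kappa -> forall u i j, cdom kappa u ->
    `|invmx (gram kappa u) i j| <= C.
  (* The zero multi-index turns the derivative bound into one on the inverse matrix itself. *)
  move=> nk u i j ku; pose z : {ffun 'I_n.+1 -> nat} := [ffun=> 0%N].
  have oz : mindex_order z = 0%N.
    by rewrite /mindex_order big1// => a; rewrite ffunE.
  have [|_] := mb kappa nk z _ i j u ku; first by rewrite oz.
  by rewrite mderivE (size0nil (etrans (size_mindex_seq z) oz)).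
split=> //.
- by move=> u; exact: transition_dom.
- by move=> u Su; exact/p2/S2.
- move=> i j; apply: (@bounded_derivs_subset _ _ (cdom kappa2) _ _ _
    (fun u => gram kappa2 u i j)) => //.
  apply: iter_pderiv_bounded => // alpha ak u ku.
  by have [] := mb _ n2 alpha ak i j u ku.
- move=> i j; apply: iter_pderiv_bounded => // alpha ak u ku.
  by have [] := mb _ n1 alpha ak i j u ku.
- by move=> u i j Su; exact/inv/S2.
- by move=> u i j Su; exact: inv.
Qed.

Unset Implicit Arguments.

Theorem proposition3p3 (R : realType) (n k : nat) (R1 R2 R3 C : R)
  (hR1 : 0 < R1) (hR2 : 0 < R2) (hR3 : 0 < R3) (hC : 0 < C) :
  exists2 D : R, 0 < D &
    forall (M : topologicalType) (A : set (rchart R M n.+1)),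
      riemannian_manifold A ->
      bounded_geometry A R1 R2 R3 ->
      metric_bound A R1 R2 R3 k.+1 C ->
      forall kappa1 kappa2 : rchart R M n.+1,
        normal_chart A R1 R2 R3 kappa1 ->
        normal_chart A R1 R2 R3 kappa2 ->
        forall alpha : {ffun 'I_n.+1 -> nat}, (mindex_order alpha <= k)%N ->
        forall u : 'rV[R]_n.+1, overlap kappa2 kappa1 u ->
          enorm (mderiv (overlap kappa2 kappa1) alpha
                   (transition kappa2 kappa1) u) <= D.
Proof.
have L0 : 0 <= R1 + R2 + R3 by rewrite !addr_ge0// ltW.
have [D D0 fD] := isometry_bounded_derivs n.+1 k.+1 hC L0.
(* The factor passes from coordinates to the Euclidean norm; the summand 1 makes the constant
   positive even if [D] is 0. *)
exists (n.+1%:R * D + 1); first by rewrite ltr_wpDl// mulr_ge0.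
move=> M A RM _ mb kappa1 kappa2 n1 n2 alpha ak u Su.
have B := normal_transition_isometry hR1 hR2 hR3 RM mb n1 n2.
have [_ dom1] := normal_chart_dom hR1 hR2 hR3 n1.
apply: (@le_trans _ _ (n.+1%:R * D)); last by rewrite lerDl.
apply: enorm_le => // a; rewrite mderivE.
have [_ <-] := iter_pderiv_coord 0 a (mindex_seq alpha)
  (bi_thick B) (bi_smooth B) Su.
have /bounded_derivsP bT := fD _ _ _ _ _ B dom1 a.
by have [] := bT (mindex_seq alpha) _ u Su; rewrite size_mindex_seq// ltnW.
Qed.
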